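(* Let $m\ge1$ and $0<\lambda<\frac14-\frac{1}{2(m+2)}$. There is a polynomial-time algorithm that, given any instance of \textsf{MaxT} (with arbitrary time windows) with $m$ hosts satisfying $p_j\le\lambda|\chi_j|$ for all jobs $j$, outputs a feasibly scheduled subset of jobs (with a feasible schedule) whose total profit is at least $\frac18-\lambda\left(\frac12+\frac1m\right)$ times the optimal profit.
   Context: \textsf{MaxT} (preemptive throughput maximization): time is slotted into integer slots $1,\dots,T$. There is a set $M$ of $m$ identical hosts, each having one unit of a single resource, and a set $J$ of jobs. Each job $j$ has a time window $\chi_j=[r_j,d_j]$ (integer slots, $|\chi_j|=d_j-r_j+1$), processing length $p_j\in\mathbb{Z}_{>0}$, resource requirement $s_j\in(0,1]$ and profit $w_j\ge0$. A subset $S\subseteq J$ is feasibly scheduled if there are sets $S_{i,t}\subseteq S$ (jobs run on host $i$ at slot $t$) such that: $j\in S_{i,t}$ only if $t\in\chi_j$; $\sum_{j\in S_{i,t}}s_j\le1$ for all $i,t$; no job runs on two different hosts in the same slot; and each $j\in S$ runs in at least $p_j$ distinct slots of $\chi_j$ (preemption and migration allowed). The goal is to maximize $\sum_{j\in S}w_j$ over feasibly scheduled $S$. *)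

(* Defs.v *)
(* MathComp world; real numbers are an abstract realType of MathComp-Analysis. *)
From HB Require Import structures.
From mathcomp Require Import all_boot all_order all_algebra.
From mathcomp Require Import boolp reals.

Set Implicit Arguments.
Unset Strict Implicit.
Unset Printing Implicit Defensive.

Import Order.TTheory GRing.Theory Num.Theory.

(** * Preemptive throughput maximization *)

Record job := Job {
  release : nat;
  deadline : nat;
  proc : nat;
  req : rat;
  profit : rat
}.

(* Rational data, so that an instance is a finite object. *)
Record instance := Instance {
  horizon : nat;
  nhosts : nat;
  jobs : seq job
}.

Definition job_ix (I : instance) := 'I_(size (jobs I)).
Definition host_ix (I : instance) := 'I_(nhosts I).

Definition job_at (I : instance) (j : job_ix I) : job := tnth (in_tuple (jobs I)) j.

Definition in_window (x : job) (t : nat) : bool := release x <= t <= deadline x.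

(* |chi_j|; the truncated subtraction is exact since release <= deadline in a
   valid instance. *)
Definition window_len (x : job) : nat := (deadline x - release x).+1.

Definition valid_job (T : nat) (x : job) : Prop :=
  [/\ 1 <= release x, release x <= deadline x, deadline x <= T, 0 < proc x &
      [/\ (0 < req x)%R, (req x <= 1)%R & (0 <= profit x)%R]].

Definition valid (I : instance) : Prop :=
  forall j : job_ix I, valid_job (horizon I) (job_at j).

Definition slack (R : realType) (lambda : R) (I : instance) : Prop :=
  forall j : job_ix I,
    ((proc (job_at j))%:R <= lambda * (window_len (job_at j))%:R)%R.

(* [sigma i t] is the set of jobs run on host [i] in slot [t]. *)
Definition schedule (I : instance) := host_ix I -> nat -> {set job_ix I}.

Definition feasible (I : instance) (S : {set job_ix I}) (sigma : schedule I) : Prop :=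
  [/\ forall i t, sigma i t \subset S,
      forall i t j, j \in sigma i t -> in_window (job_at j) t,
      forall i t, (\sum_(j in sigma i t) req (job_at j) <= 1)%R,
      forall i i' t j, j \in sigma i t -> j \in sigma i' t -> i = i' &
      forall j, j \in S ->
        proc (job_at j) <=
          count (fun t => [exists i, j \in sigma i t])
                (index_iota (release (job_at j)) (deadline (job_at j)).+1)].

Definition total_profit (I : instance) (S : {set job_ix I}) : rat :=
  (\sum_(j in S) profit (job_at j))%R.

(* The maximum profit over the feasibly schedulable sets.  The default value 0
   of the maximum is the profit of the empty set, which is always feasible, and
   profits are nonnegative in a valid instance. *)
Definition opt (I : instance) : rat :=
  \big[Num.max/0%R]_(S : {set job_ix I} | `[< exists sigma, feasible S sigma >])
     total_profit S.

(** * A model of computation: WHILE programs over binary trees of binary numbers *)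

Inductive data := Num of nat | Cons of data & data.

(* Size in bits: a number counts for the length of its binary expansion. *)
Fixpoint dsize (d : data) : nat :=
  match d with
  | Num n => (trunc_log 2 n).+1
  | Cons a b => (dsize a + dsize b).+1
  end.

Inductive binop := Add | Sub | Mul | Div | Leq.

Inductive expr :=
  | Var of nat
  | Const of data
  | Pair of expr & expr
  | Hd of expr
  | Tl of expr
  | Op of binop & expr & expr.

Inductive cmd :=
  | Skip
  | Assign of nat & expr
  | Seq of cmd & cmd
  | If of expr & cmd & cmd
  | While of expr & cmd.

Definition state := nat -> data.

Definition upd (st : state) (x : nat) (d : data) : state :=
  fun y => if y == x then d else st y.

Definition dhd (d : data) : data := if d is Cons a _ then a else Num 0.
Definition dtl (d : data) : data := if d is Cons _ b then b else Num 0.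
Definition dnum (d : data) : nat := if d is Num n then n else 0.
Definition dtrue (d : data) : bool := if d is Num 0 then false else true.

Definition binop_sem (o : binop) (x y : nat) : nat :=
  match o with
  | Add => x + y
  | Sub => x - y
  | Mul => x * y
  | Div => x %/ y
  | Leq => x <= y
  end.

Fixpoint eval (st : state) (e : expr) : data :=
  match e with
  | Var x => st x
  | Const d => d
  | Pair e1 e2 => Cons (eval st e1) (eval st e2)
  | Hd e1 => dhd (eval st e1)
  | Tl e1 => dtl (eval st e1)
  | Op o e1 e2 => Num (binop_sem o (dnum (eval st e1)) (dnum (eval st e2)))
  end.

(* Logarithmic cost: every subexpression is charged the bit size of its value, so
   that neither large numbers nor shared subtrees are manipulated for free.  All
   the primitives are computable in polynomial time on a Turing machine, so that
   polynomial cost here is equivalent to polynomial time there. *)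
Fixpoint ecost (st : state) (e : expr) : nat :=
  dsize (eval st e) +
  match e with
  | Var _ | Const _ => 0
  | Pair e1 e2 | Op _ e1 e2 => ecost st e1 + ecost st e2
  | Hd e1 | Tl e1 => ecost st e1
  end.

(* [exec c st st' k]: from [st], the program [c] halts in [st'] at cost [k]. *)
Inductive exec : cmd -> state -> state -> nat -> Prop :=
  | ExecSkip st : exec Skip st st 1
  | ExecAssign st x e :
      exec (Assign x e) st (upd st x (eval st e)) (ecost st e).+1
  | ExecSeq c1 c2 st st1 st2 k1 k2 :
      exec c1 st st1 k1 -> exec c2 st1 st2 k2 ->
      exec (Seq c1 c2) st st2 (k1 + k2).+1
  | ExecIfTrue e c1 c2 st st1 k :
      dtrue (eval st e) -> exec c1 st st1 k ->
      exec (If e c1 c2) st st1 (ecost st e + k).+1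
  | ExecIfFalse e c1 c2 st st1 k :
      ~~ dtrue (eval st e) -> exec c2 st st1 k ->
      exec (If e c1 c2) st st1 (ecost st e + k).+1
  | ExecWhileFalse e c st :
      ~~ dtrue (eval st e) -> exec (While e c) st st (ecost st e).+1
  | ExecWhileTrue e c st st1 st2 k1 k2 :
      dtrue (eval st e) -> exec c st st1 k1 -> exec (While e c) st1 st2 k2 ->
      exec (While e c) st st2 (ecost st e + k1 + k2).+1.

(* Input and output are held in variable 0, all other variables are initially 0. *)
Definition computes (c : cmd) (x y : data) (k : nat) : Prop :=
  exists st, exec c (upd (fun=> Num 0) 0 x) st k /\ st 0 = y.

(** * Encodings *)

Definition enc_seq (A : Type) (f : A -> data) (s : seq A) : data :=
  foldr (fun a d => Cons (f a) d) (Num 0) s.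

(* Only used on nonnegative rationals: the sign is dropped. *)
Definition enc_rat (q : rat) : data :=
  Cons (Num `|numq q|%N) (Num `|denq q|%N).

Definition enc_job (x : job) : data :=
  Cons (Num (release x)) (Cons (Num (deadline x)) (Cons (Num (proc x))
    (Cons (enc_rat (req x)) (enc_rat (profit x))))).

Definition enc_instance (I : instance) : data :=
  Cons (Num (horizon I)) (Cons (Num (nhosts I)) (enc_seq enc_job (jobs I))).

(* A solution is a list of selected jobs and a list of runs, a run being a job
   processed on a host in all the slots of an interval.  Slots being numbers in
   binary, the number of slots may be exponential in the size of the instance,
   hence schedules are written down by intervals rather than slot by slot. *)
Record run (I : instance) := Run {
  run_job : job_ix I;
  run_host : host_ix I;
  run_first : nat;
  run_last : nat
}.

Record solution (I : instance) := Solution {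
  sol_jobs : seq (job_ix I);
  sol_runs : seq (run I)
}.

Definition selected (I : instance) (s : solution I) : {set job_ix I} :=
  [set j in sol_jobs s].

Definition sol_schedule (I : instance) (s : solution I) : schedule I :=
  fun i t => [set j | has (fun r => [&& run_job r == j, run_host r == i &
                                      run_first r <= t <= run_last r])
                          (sol_runs s)].

Definition enc_run (I : instance) (r : run I) : data :=
  Cons (Num (run_job r)) (Cons (Num (run_host r))
    (Cons (Num (run_first r)) (Num (run_last r)))).

Definition enc_solution (I : instance) (s : solution I) : data :=
  Cons (enc_seq (fun j : job_ix I => Num j) (sol_jobs s))
       (enc_seq (@enc_run I) (sol_runs s)).

(* Program [c] runs in polynomial time on the instances satisfying [P], and
   outputs for each of them a solution satisfying [Q]. *)
Definition poly_time_solves (c : cmd) (P : instance -> Prop)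
    (Q : forall I : instance, solution I -> Prop) : Prop :=
  exists p : {poly nat}, forall I : instance, P I ->
    exists (s : solution I) (k : nat),
      [/\ computes c (enc_instance I) (enc_solution s) k,
          k <= p.[dsize (enc_instance I)]%R & Q I s].

(* Main.v *)
Require Import Defs.
From mathcomp Require Import all_boot all_order all_algebra.
From mathcomp Require Import boolp reals.
From mathcomp Require Import zify ring lra.

(* Replace every window by a largest aligned dyadic block inside it, at least a
   quarter as long, so that p_j <= lam |block_j| with lam = 4 lambda, and the
   blocks form a laminar family.  A job weighs mu_j = min(1, 2 s_j) in each slot:
   m full hosts weigh at most 2 m, and all the windows whose blocks lie in a block
   B are contained in an interval of length 4 |B|, so that the jobs of an optimal
   solution with blocks in B have total volume (sum of p_j mu_j) at most 8 m |B|.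

   Conversely, a set of jobs whose volume in each block B is at most
   |B| (m - (m + 1) lam) can be scheduled by increasing block length.  A slot that
   cannot accommodate one more job weighs at least m, except for the bad slots,
   where narrow jobs (s_j <= 1/2) fill less than half a host but keep a wide job
   from running there; a bad slot weighs at least m - 1.  Running narrow jobs
   preferably in slots where the narrow jobs fill less than half a host ensures
   that at most lam |B| slots of each block B are bad, and then volume considerations
   show that the scheduling of a job never fails.

   Jobs are selected greedily by decreasing density w_j / (p_j mu_j), as long as
   these volume bounds hold.  A rejected job lies in a tight block B, where the
   selected volume is at least kappa |B| with kappa = m - (m + 2) lam.  Covering
   the rejected jobs by maximal tight blocks compares the volumes of the selected
   and of the optimal jobs on each prefix of the order, and Abel summation turns
   this into the ratio kappa / (8 m). *)

Set Implicit Arguments.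
Unset Strict Implicit.
Unset Printing Implicit Defensive.

Local Open Scope nat_scope.

(** * Polynomial-time functions *)

(** Origin of the constants: if a job runs out of available slots in its block B, more than (1 -
    lam) |B| slots reject it. Each weighs at least m, except that at most lam |B| bad ones lack at
    most 1, so B carries more than m (1 - lam) |B| - lam |B|, which is the bound with m + 1. A
    rejected job has volume at most lam |B| itself, whence m + 2 in kappa. The hypothesis on lambda
    is kappa > 0 for lam = 4 lambda, and kappa / (8 m) is 1/8 - lambda (1/2 + 1/m).

    Increasing block length matters because everything that already runs in B when a job is placed
    there then comes from blocks inside B, and is charged to the volume of B.

    Two obstacles shape the algorithm. The number of slots can be exponential in the input size, so
    slots are grouped into segments of constant content, and one placement may create only boundedly
    many new segments. And lambda is an arbitrary real number, so the program never refers to it: it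
    depends on m alone and compares ratios found in the input. *)

Lemma leq_expl a b k : a <= b -> a ^ k <= b ^ k.
Proof. by case: k => // k ab; rewrite leq_exp2r. Qed.

(** The base [n + 2] is at least 2, so that constants and sums are absorbed by the exponent and no
    coefficients are tracked. *)
Definition polyb (f : nat -> nat) := exists k, forall n, f n <= (n + 2) ^ k.

Lemma polyb_le f g : (forall n, f n <= g n) -> polyb g -> polyb f.
Proof. by move=> fg [k gk]; exists k => n; apply: leq_trans (gk n). Qed.

Lemma polyb_id : polyb (fun n => n).
Proof. by exists 1 => n; rewrite expn1 leq_addr. Qed.

Lemma polyb_const c : polyb (fun=> c).
Proof.
exists c => n; apply: leq_trans (ltnW (ltn_expl c (isT : 1 < 2))) _.
by rewrite leq_expl ?leq_addl.
Qed.

Lemma polyb_add f g : polyb f -> polyb g -> polyb (fun n => f n + g n).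
Proof.
move=> [k fk] [l gl]; exists (maxn k l).+1 => n.
have pw a b : a <= b -> (n + 2) ^ a <= (n + 2) ^ b by move=> ab; rewrite leq_exp2l ?addn2.
have := leq_add (leq_trans (fk n) (pw _ _ (leq_maxl k l)))
                (leq_trans (gl n) (pw _ _ (leq_maxr k l))).
by move=> /leq_trans; apply; rewrite addnn -mul2n expnS leq_mul2r leq_addl orbT.
Qed.

Lemma polyb_mul f g : polyb f -> polyb g -> polyb (fun n => f n * g n).
Proof. by move=> [k fk] [l gl]; exists (k + l) => n; rewrite expnD leq_mul. Qed.

Lemma polyb_S f : polyb f -> polyb (fun n => (f n).+1).
Proof.
by move=> pf; apply: polyb_le (polyb_add pf (polyb_const 1)) => n; rewrite addn1.
Qed.

Lemma polyb_expn f k : polyb f -> polyb (fun n => f n ^ k).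
Proof. by case=> l fl; exists (l * k) => n; rewrite expnM leq_expl. Qed.

Ltac solve_polyb := repeat first [exact: polyb_id | exact: polyb_const |
  assumption | apply: polyb_add | apply: polyb_mul | apply: polyb_S | apply: polyb_expn].

(** * Encoded types and programs computing functions between them *)

Class Enc (T : Type) := enc : T -> data.

#[global] Instance enc_nat : Enc nat := Defs.Num.
#[global] Instance enc_bool : Enc bool := fun b : bool => Defs.Num b.
#[global] Instance enc_prod A B (eA : Enc A) (eB : Enc B) : Enc (A * B) :=
  fun x => Defs.Cons (enc x.1) (enc x.2).
#[global] Instance enc_list A (eA : Enc A) : Enc (seq A) := enc_seq enc.

Definition esize {T} {eT : Enc T} (x : T) := dsize (enc x).

Lemma dsize_gt0 d : 0 < dsize d. Proof. by case: d. Qed.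

Lemma esize_gt0 T (eT : Enc T) (x : T) : 0 < esize x. Proof. exact: dsize_gt0. Qed.

(** The other variables start with arbitrary contents, and those from [N] on are preserved: programs
    can thus be chained and iterated, with intermediate values parked from [N] on. The output size
    is bounded along with the cost, because the cost does not control it ([Skip] returns its whole
    input at cost 1) and composition needs it. *)
Definition PT {X Y} {eX : Enc X} {eY : Enc Y} (f : X -> Y) : Prop :=
  exists c N k, forall x st, st 0 = enc x -> exists st' q,
    [/\ exec c st st' q, st' 0 = enc (f x),
        forall y, N <= y -> st' y = st y & q + esize (f x) <= (esize x + 2) ^ k].

Section Combinators.
Context {X Y : Type} {eX : Enc X} {eY : Enc Y}.

Lemma PT_intro (f : X -> Y) c N b : polyb b ->
  (forall x st, st 0 = enc x -> exists st' q,
    [/\ exec c st st' q, st' 0 = enc (f x),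
        forall y, N <= y -> st' y = st y & q + esize (f x) <= b (esize x)]) ->
  PT f.
Proof.
move=> [k bk] H; exists c, N, k => x st /H [st' [q [H1 H2 H3 H4]]].
by exists st', q; split=> //; apply: leq_trans H4 _.
Qed.

Lemma PT_size (f : X -> Y) : PT f -> exists k, forall x, esize (f x) <= (esize x + 2) ^ k.
Proof.
move=> [c [N [k H]]]; exists k => x.
have [st' [q [_ _ _]]] := H x (upd (fun=> Defs.Num 0) 0 (enc x)) erefl.
by apply: leq_trans; rewrite leq_addl.
Qed.

Lemma PT_ext (f g : X -> Y) : f =1 g -> PT f -> PT g.
Proof.
move=> fg [c [N [k H]]]; exists c, N, k => x st /H [st' [q]].
by rewrite fg => ?; exists st', q.
Qed.

Lemma PT_const (y : Y) : PT (fun _ : X => y).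
Proof.
apply: (@PT_intro _ (Assign 0 (Const (enc y))) 1 (fun=> (2 * esize y).+1)).
  exact: polyb_const.
move=> x st st0; exists (upd st 0 (enc y)), (esize y + 0).+1; split=> //.
- exact: (ExecAssign st 0 (Const (enc y))).
- by case.
- by rewrite addn0 mul2n -addnn.
Qed.

End Combinators.

Lemma PT_comp X Y Z (eX : Enc X) (eY : Enc Y) (eZ : Enc Z) (f : X -> Y) (g : Y -> Z) :
  PT f -> PT g -> PT (fun x => g (f x)).
Proof.
move=> [c1 [N1 [k1 H1]]] [c2 [N2 [k2 H2]]].
apply: (@PT_intro _ _ _ _ _ (Seq c1 c2) (maxn N1 N2)
  (fun n => (n + 2) ^ k1 + ((n + 2) ^ k1 + 2) ^ k2 + 1)); first by solve_polyb.
move=> x st /H1 [st1 [q1 [E1 /H2 [st2 [q2 [E2 S2 F2 B2]]] F1 B1]]].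
exists st2, (q1 + q2).+1; split=> //.
- exact: ExecSeq E1 E2.
- by move=> y; rewrite geq_max => /andP[? ?]; rewrite F2 // F1.
- have : (esize (f x) + 2) ^ k2 <= ((esize x + 2) ^ k1 + 2) ^ k2.
    by rewrite leq_expl ?leq_add2r //; apply: leq_trans B1; rewrite leq_addl.
  lia.
Qed.

Lemma PT_id X (eX : Enc X) : PT (fun x : X => x).
Proof.
apply: (@PT_intro _ _ _ _ _ Skip 0 (fun n => n.+1)); first by solve_polyb.
by move=> x st st0; exists st, 1; split=> //; constructor.
Qed.

Lemma upd_same st x d : upd st x d x = d.
Proof. by rewrite /upd eqxx. Qed.

Lemma upd_other st x d y : y != x -> upd st x d y = st y.
Proof. by rewrite /upd => /negbTE ->. Qed.

Arguments upd : simpl never.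

Ltac upds := repeat first [rewrite upd_same | rewrite upd_other; last by lia].

(** Both programs read and write variable 0, so the input is parked in [N] and the first result in
    [N.+1], out of reach of either program. *)
Lemma PT_pair X Y Z (eX : Enc X) (eY : Enc Y) (eZ : Enc Z) (f : X -> Y) (g : X -> Z) :
  PT f -> PT g -> PT (fun x => (f x, g x)).
Proof.
move=> [c1 [N1 [k1 H1]]] [c2 [N2 [k2 H2]]].
have [N [N0 N1N N2N]] : exists N, [/\ 0 < N, N1 <= N & N2 <= N].
  by exists (maxn N1 N2).+1; split; lia.
apply: (@PT_intro _ _ _ _ _ (Seq (Assign N (Var 0)) (Seq c1 (Seq (Assign N.+1 (Var 0))
   (Seq (Assign 0 (Var N)) (Seq c2 (Assign 0 (Pair (Var N.+1) (Var 0))))))))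
  N.+2 (fun n => 2 * n + 20 + 5 * ((n + 2) ^ k1 + (n + 2) ^ k2))); first by solve_polyb.
move=> x st st0.
have [|st1 [q1 [E1 S1 F1 B1]]] := H1 x (upd st N (st 0)); first by upds.
have [|st2 [q2 [E2 S2 F2 B2]]] := H2 x (upd (upd st1 N.+1 (st1 0)) 0 (st1 N)).
  by upds; rewrite F1 //; upds.
have e1 : st1 N = enc x by rewrite F1 //; upds.
have e2 : st2 N.+1 = enc (f x) by rewrite F2 ?(leqW N2N) //; upds.
eexists _, _; split.
- apply: ExecSeq; first exact: ExecAssign.
  apply: ExecSeq; first exact: E1.
  apply: ExecSeq; first exact: ExecAssign.
  apply: ExecSeq; first exact: ExecAssign.
  apply: ExecSeq; first by rewrite /=; upds; exact: E2.
  exact: ExecAssign.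
- by upds; rewrite /= S2 e2.
- move=> y Ny; upds; rewrite F2; last by lia.
  by upds; rewrite F1 ?upd_other //; lia.
- rewrite /= S2 e2; upds; rewrite e1 S1; upds; rewrite st0.
  move: B1 B2; rewrite /esize -[enc (f x, g x)]/(Defs.Cons (enc (f x)) (enc (g x))) /=.
  set a := dsize _; set b := dsize _; set d := dsize _.
  lia.
Qed.

Lemma esize_pair A B (eA : Enc A) (eB : Enc B) (a : A) (b : B) :
  esize (a, b) = (esize a + esize b).+1.
Proof. by []. Qed.

Lemma esize_cons A (eA : Enc A) (a : A) s : esize (a :: s) = (esize a + esize s).+1.
Proof. by []. Qed.

Lemma PT_expr X Y (eX : Enc X) (eY : Enc Y) (f : X -> Y) (e : expr) b :
  polyb b ->
  (forall x st, st 0 = enc x -> eval st e = enc (f x) /\ ecost st e <= b (esize x)) ->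
  PT f.
Proof.
move=> pb H; apply: (@PT_intro _ _ _ _ _ (Assign 0 e) 1 (fun n => (2 * b n).+1)).
  by solve_polyb.
move=> x st /H [ev co]; exists (upd st 0 (enc (f x))), (ecost st e).+1; split=> //.
- by rewrite -ev; constructor.
- by move=> y y0; upds.
- have : esize (f x) <= ecost st e by rewrite /esize -ev; case: (e) => *; rewrite leq_addr.
  lia.
Qed.

Lemma PT_fst X A B (eX : Enc X) (eA : Enc A) (eB : Enc B) (g : X -> A * B) :
  PT g -> PT (fun x => (g x).1).
Proof.
move=> pg; apply: (PT_comp pg (g := fst)); apply: (@PT_expr _ _ _ _ _ (Hd (Var 0)) (fun n => 3 * n)).
  by solve_polyb.
move=> [a b] st st0; rewrite /= st0; split=> //.
rewrite -[enc (a, b)]/(Defs.Cons (enc a) (enc b)) /= esize_pair /esize; lia.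
Qed.

Lemma PT_snd X A B (eX : Enc X) (eA : Enc A) (eB : Enc B) (g : X -> A * B) :
  PT g -> PT (fun x => (g x).2).
Proof.
move=> pg; apply: (PT_comp pg (g := snd)); apply: (@PT_expr _ _ _ _ _ (Tl (Var 0)) (fun n => 3 * n)).
  by solve_polyb.
move=> [a b] st st0; rewrite /= st0; split=> //.
rewrite -[enc (a, b)]/(Defs.Cons (enc a) (enc b)) /= esize_pair /esize; lia.
Qed.

Lemma PT_cons X A (eX : Enc X) (eA : Enc A) (g : X -> A) (h : X -> seq A) :
  PT g -> PT h -> PT (fun x => g x :: h x).
Proof.
move=> pg ph; apply: (PT_comp (PT_pair pg ph) (g := fun z => z.1 :: z.2)).
apply: (@PT_expr _ _ _ _ _ (Var 0) (fun n => n)); first by solve_polyb.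
by move=> [a s] st st0; rewrite /= st0 addn0.
Qed.

(** * Arithmetic on binary numbers *)

Lemma esize_nat (n : nat) : esize n = (trunc_log 2 n).+1. Proof. by []. Qed.

Lemma esize_le (m n : nat) : m <= n -> esize m <= esize n.
Proof. by move=> mn; rewrite !esize_nat ltnS leq_trunc_log. Qed.

Lemma trunc_log2_lt n : n < 2 ^ (trunc_log 2 n).+1.
Proof. by case: n => // n; apply: trunc_log_ltn. Qed.

Lemma esize_lt (n k : nat) : 0 < k -> n < 2 ^ k -> esize n <= k.
Proof.
move=> k0 nk; rewrite esize_nat; case: n nk => [|n] nk; first by rewrite trunc_log0.
have := trunc_logP (isT : 1 < 2) (isT : 0 < n.+1).
by move=> /leq_ltn_trans /(_ nk); rewrite ltn_exp2l.
Qed.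

Lemma esize_add (m n : nat) : esize (m + n) <= esize m + esize n.
Proof.
apply: esize_lt; first by rewrite addn_gt0 esize_gt0.
rewrite !esize_nat; have := trunc_log2_lt m; have := trunc_log2_lt n.
rewrite expnD.
have : 2 <= 2 ^ (trunc_log 2 m).+1 by rewrite expnS leq_pmulr ?expn_gt0.
have : 2 <= 2 ^ (trunc_log 2 n).+1 by rewrite expnS leq_pmulr ?expn_gt0.
move: (2 ^ _) (2 ^ _); nia.
Qed.

Lemma esize_mul (m n : nat) : esize (m * n) <= esize m + esize n.
Proof.
apply: esize_lt; first by rewrite addn_gt0 esize_gt0.
by rewrite expnD !esize_nat ltn_mul ?trunc_log2_lt.
Qed.

Lemma esize_binop o (m n : nat) : esize (binop_sem o m n) <= esize m + esize n.
Proof.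
case: o => /=; first exact: esize_add.
- by apply: leq_trans (leq_addr _ _); apply: esize_le; rewrite leq_subr.
- exact: esize_mul.
- by apply: leq_trans (leq_addr _ _); apply: esize_le; rewrite leq_div.
- by case: (m <= n); rewrite addn_gt0 esize_gt0.
Qed.

Lemma PT_binop o X (eX : Enc X) (g h : X -> nat) :
  PT g -> PT h -> PT (fun x => binop_sem o (g x) (h x)).
Proof.
move=> pg ph; apply: (PT_comp (PT_pair pg ph) (g := fun z => binop_sem o z.1 z.2)).
apply: (@PT_expr _ _ _ _ _ (Op o (Hd (Var 0)) (Tl (Var 0))) (fun n => 5 * n)).
  by solve_polyb.
move=> [m n] st st0; rewrite /= st0; split=> //.
rewrite -[enc (m, n)]/(Defs.Cons (Defs.Num m) (Defs.Num n)) esize_pair.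
have := esize_binop o m n; rewrite /esize /enc /enc_nat /=; lia.
Qed.

Section Arith.
Context {X : Type} {eX : Enc X}.
Implicit Types g h : X -> nat.

Lemma PT_addn g h : PT g -> PT h -> PT (fun x => g x + h x).
Proof. exact: (PT_binop Add). Qed.
Lemma PT_subn g h : PT g -> PT h -> PT (fun x => g x - h x).
Proof. exact: (PT_binop Defs.Sub). Qed.
Lemma PT_muln g h : PT g -> PT h -> PT (fun x => g x * h x).
Proof. exact: (PT_binop Mul). Qed.
Lemma PT_divn g h : PT g -> PT h -> PT (fun x => g x %/ h x).
Proof. exact: (PT_binop Div). Qed.

Lemma PT_succn g : PT g -> PT (fun x => (g x).+1).
Proof.
move=> pg; apply: (PT_ext (f := fun x => g x + 1)) => [x|]; first by rewrite addn1.
by apply: PT_addn => //; apply: PT_const.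
Qed.

Lemma PT_leq g h : PT g -> PT h -> PT (fun x => g x <= h x).
Proof. exact: (PT_binop Leq). Qed.

End Arith.

(** * Branching and iteration *)

Lemma PT_if X Y (eX : Enc X) (eY : Enc Y) (b : X -> bool) (f g : X -> Y) :
  PT b -> PT f -> PT g -> PT (fun x => if b x then f x else g x).
Proof.
move=> [c0 [N0 [k0 H0]]] [c1 [N1 [k1 H1]]] [c2 [N2 [k2 H2]]].
have [N [N00 N0N N1N N2N]] : exists N, [/\ 0 < N, N0 <= N, N1 <= N & N2 <= N].
  by exists (maxn N0 (maxn N1 N2)).+1; split; lia.
apply: (@PT_intro _ _ _ _ _ (Seq (Assign N (Var 0)) (Seq c0 (If (Var 0)
   (Seq (Assign 0 (Var N)) c1) (Seq (Assign 0 (Var N)) c2))))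
  N.+1 (fun n => 2 * n + 20 + 2 * ((n + 2) ^ k0 + (n + 2) ^ k1 + (n + 2) ^ k2))); first by solve_polyb.
move=> x st st0.
have [|st1 [q1 [E1 S1 F1 B1]]] := H0 x (upd st N (st 0)); first by upds.
have s1N : st1 N = enc x by rewrite F1 //; upds.
have fr N' st2 : N' <= N -> (forall y, N' <= y -> st2 y = upd st1 0 (st1 N) y) ->
    forall y, N < y -> st2 y = st y.
  by move=> N'N F y Ny; rewrite F ?upd_other ?F1 ?upd_other //; lia.
have [E0 C0] : eval st1 (Var 0) = enc (b x) /\ ecost st1 (Var 0) <= 1.
  by rewrite /= S1; split=> //; case: (b x).
case: ifP => bx.
- have [|st2 [q2 [E2 S2 F2 B2]]] := H1 x (upd st1 0 (st1 N)); first by upds.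
  eexists _, _; split; last 1 first.
  + rewrite bx in B1; have := esize_gt0 _ (f x); move: B1 B2.
    instantiate (1 := ((esize x).+1 + (q1 + (ecost st1 (Var 0) + ((esize x).+1 + q2).+1).+1).+1).+1).
    lia.
  + apply: ExecSeq.
      have -> : (esize x).+1 = (ecost st (Var 0)).+1 by rewrite /= st0 addn0.
      exact: ExecAssign.
    apply: ExecSeq; first exact: E1.
    apply: ExecIfTrue; first by rewrite E0 bx.
    apply: ExecSeq; last exact: E2.
    have -> : (esize x).+1 = (ecost st1 (Var N)).+1 by rewrite /= s1N addn0.
    exact: ExecAssign.
  + exact: S2.
  + exact: fr F2.
- have [|st2 [q2 [E2 S2 F2 B2]]] := H2 x (upd st1 0 (st1 N)); first by upds.
  eexists _, _; split; last 1 first.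
  + move: B1 B2.
    instantiate (1 := ((esize x).+1 + (q1 + (ecost st1 (Var 0) + ((esize x).+1 + q2).+1).+1).+1).+1).
    lia.
  + apply: ExecSeq.
      have -> : (esize x).+1 = (ecost st (Var 0)).+1 by rewrite /= st0 addn0.
      exact: ExecAssign.
    apply: ExecSeq; first exact: E1.
    apply: ExecIfFalse; first by rewrite E0 bx.
    apply: ExecSeq; last exact: E2.
    have -> : (esize x).+1 = (ecost st1 (Var N)).+1 by rewrite /= s1N addn0.
    exact: ExecAssign.
  + exact: S2.
  + exact: fr F2.
Qed.

Lemma PT_andb X (eX : Enc X) (b c : X -> bool) : PT b -> PT c -> PT (fun x => b x && c x).
Proof. by move=> pb pc; apply: PT_if => //; apply: PT_const. Qed.

Lemma PT_negb X (eX : Enc X) (b : X -> bool) : PT b -> PT (fun x => ~~ b x).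
Proof. by move=> pb; apply: (PT_if pb); apply: PT_const. Qed.

Lemma esize_take A (eA : Enc A) (s : seq A) i : esize (take i s) <= esize s.
Proof.
elim: s i => [|a s IH] [|i] //=; rewrite ?esize_cons ?ltnS ?leq_add2l //.
Qed.

Lemma size_esize A (eA : Enc A) (s : seq A) : size s < esize s.
Proof. by elim: s => // a s IH; rewrite /= esize_cons; have := esize_gt0 _ a; lia. Qed.

(** A polynomial step may double the accumulator, hence make it exponential when iterated; this is
    why all intermediate accumulators are required to have polynomial size. Variable [N] holds the
    parameter, [N.+1] the rest of the list and [N.+2] the accumulator. *)
Lemma PT_foldl X A E (eX : Enc X) (eA : Enc A) (eE : Enc E)
    (step : X -> A -> E -> A) (i : X -> A) (l : X -> seq E) b :
  PT (fun z : X * A * E => step z.1.1 z.1.2 z.2) -> PT i -> PT l -> polyb b ->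
  (forall x k, esize (foldl (step x) (i x) (take k (l x))) <= b (esize x)) ->
  PT (fun x => foldl (step x) (i x) (l x)).
Proof.
move=> [cs [Ns [ks Hs]]] [ci [Ni [ki Hi]]] [cl [Nl [kl Hl]]] pb Hb.
have [N [N0 NsN NiN NlN]] : exists N, [/\ 0 < N, Ns <= N, Ni <= N & Nl <= N].
  by exists (maxn Ns (maxn Ni Nl)).+1; split; lia.
pose body := Seq (Assign 0 (Pair (Pair (Var N) (Var N.+2)) (Hd (Var N.+1))))
  (Seq cs (Seq (Assign N.+2 (Var 0)) (Assign N.+1 (Tl (Var N.+1))))).
(* Bound on the cost of one iteration, where [M] bounds the accumulator together with the rest of
   the list. *)
pose K n M := 20 * (n + M) + 50 + (n + M + 4) ^ ks.
have loop x M (L : seq E) a st : st N = enc x -> st N.+1 = enc L -> st N.+2 = enc a ->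
    (forall k, esize (foldl (step x) a (take k L)) + esize L <= M) ->
    exists st' q, [/\ exec (While (Var N.+1) body) st st' q,
      st' N.+2 = enc (foldl (step x) a L), forall y, N.+3 <= y -> st' y = st y &
      q <= (size L).+1 * K (esize x) M].
  elim: L a st => [|e L IH] a st sN sl sa HM.
    exists st, (ecost st (Var N.+1)).+1; split=> //.
      by apply: ExecWhileFalse; rewrite /= sl.
    by rewrite /= sl mul1n /K /= (_ : trunc_log 2 0 = 0) //; lia.
  have Ma := HM 0; rewrite take0 /= esize_cons in Ma.
  have M1 : esize (step x a e) + esize L <= M.
    by have := HM 1; rewrite /= take0 /= esize_cons; lia.
  have [|st1 [q1 [E1 S1 F1 B1]]] := Hs (x, a, e) (upd st 0 (enc (x, a, e))); first by upds.
  have sl1 : st1 N.+1 = enc (e :: L) by rewrite F1 ?upd_other //; lia.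
  have [||||st3 [q3 [E3 S3 F3 B3]]] := IH (step x a e) (upd (upd st1 N.+2 (enc (step x a e))) N.+1 (enc L)).
  - by upds; rewrite F1 ?upd_other //; lia.
  - by upds.
  - by upds.
  - move=> k; have := HM k.+1; rewrite /= esize_cons; lia.
  eexists _, _; split.
  - apply: ExecWhileTrue; [by rewrite /= sl | | exact: E3].
    apply: ExecSeq; first exact: ExecAssign.
    rewrite /= sN sa sl /=.
    apply: ExecSeq; first exact: E1.
    rewrite -S1.
    apply: ExecSeq; first exact: ExecAssign.
    have -> : enc L = eval (upd st1 N.+2 (eval st1 (Var 0))) (Tl (Var N.+1)).
      by rewrite /=; upds; rewrite sl1.
    exact: ExecAssign.
  - exact: S3.
  - move=> y yN; rewrite F3 //; upds; rewrite F1; last by lia.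
    by upds.
  - move: B1 B3; rewrite /= sl sN sa /=; upds; rewrite sl1 S1 /=.
    rewrite !esize_pair -[enc_list eE L]/(enc L) -!/(esize _).
    have : (((esize x + esize a).+1 + esize e).+1 + 2) ^ ks <= (esize x + M + 4) ^ ks.
      by apply: leq_expl; lia.
    move=> P B1 B3; rewrite mulSn {1}/K; move: P B1 B3.
    move: (_ * K _ _) (_ ^ ks) (_ ^ ks) => p1 p2 p3.
    move: Ma M1; move: (esize x) (esize a) (esize e) (esize L) (esize (step x a e)).
    lia.
apply: (@PT_intro _ _ _ _ _ (Seq (Assign N (Var 0)) (Seq cl (Seq (Assign N.+1 (Var 0))
   (Seq (Assign 0 (Var N)) (Seq ci (Seq (Assign N.+2 (Var 0))
   (Seq (While (Var N.+1) body) (Assign 0 (Var N.+2)))))))))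
  N.+3 (fun n => 5 * n + 30 + 5 * ((n + 2) ^ kl + (n + 2) ^ ki) + 5 * b n +
     ((n + 2) ^ kl).+1 * K n (b n + (n + 2) ^ kl))).
  by rewrite /K; solve_polyb.
move=> x st st0.
have [|st1 [q1 [E1 S1 F1 B1]]] := Hl x (upd st N (st 0)); first by upds.
have s1N : st1 N = enc x by rewrite F1 //; upds.
have [|st2 [q2 [E2 S2 F2 B2]]] := Hi x (upd (upd st1 N.+1 (st1 0)) 0 (enc x)); first by upds.
have s2N : st2 N = enc x by rewrite F2 //; upds.
have s2l : st2 N.+1 = enc (l x) by rewrite F2 ?(leqW NiN) //; upds.
have [||||st3 [q3 [E3 S3 F3 B3]]] :=
   loop x (b (esize x) + (esize x + 2) ^ kl) (l x) (i x) (upd st2 N.+2 (st2 0)).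
- by upds.
- by upds.
- by upds.
- by move=> k; apply: leq_add => //; lia.
have := Hb x (size (l x)); rewrite take_size.
set r := foldl _ _ _ => Hr; rewrite -/r in S3.
exists (upd st3 0 (enc r)).
exists ((esize x).+1 + (q1 + ((esize (l x)).+1 + ((esize x).+1 + (q2 + ((esize (i x)).+1 +
   (q3 + (esize r).+1).+1).+1).+1).+1).+1).+1).+1; split.
- apply: ExecSeq.
    have -> : (esize x).+1 = (ecost st (Var 0)).+1 by rewrite /= st0 addn0.
    exact: ExecAssign.
  apply: ExecSeq; first exact: E1.
  apply: ExecSeq.
    have -> : (esize (l x)).+1 = (ecost st1 (Var 0)).+1 by rewrite /= S1 addn0.
    exact: ExecAssign.
  apply: ExecSeq.
    have -> : (esize x).+1 = (ecost (upd st1 N.+1 (eval st1 (Var 0))) (Var N)).+1.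
      by rewrite /=; upds; rewrite s1N addn0.
    exact: ExecAssign.
  have -> : eval (upd st1 N.+1 (eval st1 (Var 0))) (Var N) = enc x by rewrite /=; upds.
  apply: ExecSeq; first exact: E2.
  apply: ExecSeq.
    have -> : (esize (i x)).+1 = (ecost st2 (Var 0)).+1 by rewrite /= S2 addn0.
    exact: ExecAssign.
  apply: ExecSeq; first exact: E3.
  have -> : (esize r).+1 = (ecost st3 (Var N.+2)).+1 by rewrite /= S3 addn0.
  rewrite -S3; exact: ExecAssign.
- by upds.
- move=> y yN; upds; rewrite F3 // upd_other; last by lia.
  rewrite F2; last by lia.
  upds; rewrite F1; last by lia.
  by upds.
- have : (size (l x)).+1 * K (esize x) (b (esize x) + (esize x + 2) ^ kl) <=
     ((esize x + 2) ^ kl).+1 * K (esize x) (b (esize x) + (esize x + 2) ^ kl).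
    apply: leq_mul => //; rewrite ltnS; apply: leq_trans B1.
    by apply: leq_trans (leq_addl _ _); rewrite ltnW // size_esize.
  lia.
Qed.

(** If a step enlarges the accumulator by an amount that depends only on the parameter and the list
    element, these amounts add up along the list and the size condition of [PT_foldl] is
    automatic. *)
Lemma PT_foldl_add X A E (eX : Enc X) (eA : Enc A) (eE : Enc E)
    (step : X -> A -> E -> A) (i : X -> A) (l : X -> seq E) b :
  PT (fun z : X * A * E => step z.1.1 z.1.2 z.2) -> PT i -> PT l -> polyb b ->
  (forall x a e, esize (step x a e) <= esize a + b (esize x + esize e)) ->
  PT (fun x => foldl (step x) (i x) (l x)).
Proof.
move=> ps pi pl [k bk] Hb.
have Hk x a e : esize (step x a e) <= esize a + (esize x + esize e + 2) ^ k.
  by apply: leq_trans (Hb _ _ _) _; rewrite leq_add2l.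
have [ki Hi] := PT_size pi; have [kl Hl] := PT_size pl.
apply: (@PT_foldl _ _ _ _ _ _ _ _ _
  (fun n => (n + 2) ^ ki + (n + 2) ^ kl * (n + (n + 2) ^ kl + 2) ^ k)) => //.
  by solve_polyb.
move=> x j; set M := (esize x + esize (l x) + 2) ^ k.
have step_le L a : esize L <= esize (l x) ->
    esize (foldl (step x) a L) <= esize a + size L * M.
  elim: L a => [|e L IH] a /=; first by rewrite addn0.
  rewrite esize_cons => eL.
  apply: leq_trans (IH _ _) _; first by lia.
  rewrite mulSn addnA leq_add2r; apply: leq_trans (Hk _ _ _) _.
  by rewrite leq_add2l; apply: leq_expl; lia.
apply: leq_trans (step_le _ _ (esize_take _ _ _)) _.
apply: leq_add; first exact: Hi.
apply: leq_mul; last by apply: leq_expl; rewrite leq_add2r leq_add2l.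
apply: leq_trans (Hl x); apply: leq_trans (ltnW (size_esize _ _)).
by rewrite size_take; case: ltnP => // /ltnW.
Qed.

Definition pow2 n := 2 ^ trunc_log 2 n.

(** Repeated doubling, with the argument in variable 1 and the current power in variable 0; the
    number of iterations is linear in the bit size of the argument. *)
Lemma PT_pow2 X (eX : Enc X) (g : X -> nat) : PT g -> PT (fun x => pow2 (g x)).
Proof.
move=> pg; apply: (PT_comp pg).
pose two := Const (Defs.Num 2).
pose tst := Op Leq (Op Mul two (Var 0)) (Var 1).
pose w := While tst (Assign 0 (Op Mul two (Var 0))).
have loop d n k st : k + d = trunc_log 2 n -> st 0 = enc (2 ^ k) -> st 1 = enc n ->
    exists st' q, [/\ exec w st st' q, st' 0 = enc (pow2 n),
      forall y, 2 <= y -> st' y = st y & q <= d.+1 * (20 * esize n + 50)].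
  have cst k' st' : k' <= trunc_log 2 n -> st' 0 = enc (2 ^ k') -> st' 1 = enc n ->
      ecost st' tst <= 10 * esize n + 20 /\
      ecost st' (Op Mul two (Var 0)) <= 5 * esize n + 10.
    move=> kn s0 s1; rewrite /= s0 s1 /=.
    have := esize_mul 2 (2 ^ k'); have := esize_binop Leq (2 * 2 ^ k') n.
    have : esize (2 ^ k') <= esize n by rewrite !esize_nat trunc_expnK.
    have : esize 2 <= 2 by [].
    rewrite !esize_nat /=; lia.
  elim: d k st => [|d IH] k st kd s0 s1.
    have [c1 _] := cst _ _ (leq_trans (leq_addr 0 k) (eq_leq kd)) s0 s1.
    exists st, (ecost st tst).+1; split=> //; last by lia.
    - apply: ExecWhileFalse; rewrite /= s0 s1 /=.
      rewrite -expnS ltn_geF //; rewrite -(addn0 k) kd; exact: trunc_log2_lt.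
    - by rewrite s0 /pow2 -kd addn0.
  have kn : k <= trunc_log 2 n by rewrite -kd leq_addr.
  have [c1 c2] := cst _ _ kn s0 s1.
  have [|||st' [q [E S F B]]] := IH k.+1 (upd st 0 (enc (2 ^ k.+1))).
  - by rewrite -kd addnS.
  - by upds.
  - by upds.
  exists st', (ecost st tst + (ecost st (Op Mul two (Var 0))).+1 + q).+1; split=> //.
  - apply: (ExecWhileTrue (st1 := upd st 0 (enc (2 ^ k.+1)))) => //.
      rewrite /= s0 s1 /= -expnS.
      have -> // : 2 ^ k.+1 <= n.
      have n0 : 0 < n by case: (n) kd => //; rewrite trunc_log0 addnS.
      apply: leq_trans (trunc_logP (isT : 1 < 2) n0); rewrite -kd leq_exp2l //; lia.
    have -> : enc (2 ^ k.+1) = eval st (Op Mul two (Var 0)) by rewrite /= s0 /= expnS.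
    exact: ExecAssign.
  - by move=> y y2; rewrite F //; upds.
  - by rewrite mulSn; lia.
apply: (@PT_intro _ _ _ _ _ (Seq (Assign 1 (Var 0)) (Seq (Assign 0 (Const (Defs.Num 1))) w)) 2
  (fun n => 5 * n + 20 + (n + 1) * (20 * n + 50))); first by solve_polyb.
move=> n st st0.
have [|||st' [q [E S F B]]] := loop (trunc_log 2 n) n 0 (upd (upd st 1 (enc n)) 0 (enc 1)).
- by [].
- by upds.
- by upds.
exists st', ((esize n).+1 + (2 + q).+1).+1; split=> //.
- apply: ExecSeq.
    have -> : (esize n).+1 = (ecost st (Var 0)).+1 by rewrite /= st0 addn0.
    exact: ExecAssign.
  apply: ExecSeq; last exact: E.
  rewrite /= st0; exact: (ExecAssign _ 0 (Const (Defs.Num 1))).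
- by move=> y y2; rewrite F //; upds.
- have : esize (pow2 n) <= esize n by rewrite !esize_nat /pow2 trunc_expnK.
  rewrite [in esize n](esize_nat n) in B *; move: B; rewrite !esize_nat.
  nia.
Qed.

(** * List operations *)

Lemma PT_rev X A (eX : Enc X) (eA : Enc A) (s : X -> seq A) :
  PT s -> PT (fun x => rev (s x)).
Proof.
move=> ps; apply: (PT_ext (f := fun x => foldl (fun a e => e :: a) [::] (s x))).
  move=> x; suff H t u : foldl (fun a (e : A) => e :: a) u t = rev t ++ u by rewrite H cats0.
  by elim: t u => //= e t IH u; rewrite IH rev_cons cat_rcons.
apply: (PT_foldl_add (step := fun _ a e => e :: a) (b := fun n => n.+1)) => //.
- by apply: PT_cons; [apply/PT_snd/PT_id | apply/PT_snd/PT_fst/PT_id].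
- exact: PT_const.
- by solve_polyb.
- by move=> x a e; rewrite esize_cons; lia.
Qed.

Lemma PT_cat X A (eX : Enc X) (eA : Enc A) (s t : X -> seq A) :
  PT s -> PT t -> PT (fun x => s x ++ t x).
Proof.
move=> ps pt; apply: (PT_ext (f := fun x => foldl (fun a e => e :: a) (t x) (rev (s x)))).
  move=> x; suff H u v : foldl (fun a (e : A) => e :: a) u v = rev v ++ u by rewrite H revK.
  by elim: v u => //= e v IH u; rewrite IH rev_cons cat_rcons.
apply: (PT_foldl_add (step := fun _ a e => e :: a) (b := fun n => n.+1)) => //.
- by apply: PT_cons; [apply/PT_snd/PT_id | apply/PT_snd/PT_fst/PT_id].
- exact: PT_rev.
- by solve_polyb.
- by move=> x a e; rewrite esize_cons; lia.
Qed.

Lemma PT_step2 X A B C (eX : Enc X) (eA : Enc A) (eB : Enc B) (eC : Enc C)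
    (f : X -> B -> C) :
  PT (fun z : X * B => f z.1 z.2) -> PT (fun z : X * A * B => f z.1.1 z.2).
Proof.
move=> pf; apply: (PT_comp (f := fun z : X * A * B => (z.1.1, z.2)) _ pf).
by apply: PT_pair; [apply/PT_fst/PT_fst/PT_id | apply/PT_snd/PT_id].
Qed.

Lemma PT_map X A B (eX : Enc X) (eA : Enc A) (eB : Enc B) (f : X -> A -> B) (s : X -> seq A) :
  PT (fun z : X * A => f z.1 z.2) -> PT s -> PT (fun x => map (f x) (s x)).
Proof.
move=> pf ps; apply: (PT_ext (f := fun x => rev (foldl (fun a e => f x e :: a) [::] (s x)))).
  move=> x; suff H t u : foldl (fun a (e : A) => f x e :: a) u t = rev (map (f x) t) ++ u.
    by rewrite H cats0 revK.
  by elim: t u => //= e t IH u; rewrite IH rev_cons cat_rcons.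
have [k Hk] := PT_size pf.
apply: PT_rev; apply: (PT_foldl_add (step := fun x a e => f x e :: a)
  (b := fun n => (n + 1 + 2) ^ k + 1)) => //.
- by apply: PT_cons; [exact: PT_step2 | apply/PT_snd/PT_fst/PT_id].
- exact: PT_const.
- by solve_polyb.
- by move=> x a e; rewrite esize_cons; have := Hk (x, e); rewrite esize_pair /= !addn1; lia.
Qed.

Lemma PT_filter X A (eX : Enc X) (eA : Enc A) (p : X -> A -> bool) (s : X -> seq A) :
  PT (fun z : X * A => p z.1 z.2) -> PT s -> PT (fun x => filter (p x) (s x)).
Proof.
move=> pp ps; apply: (PT_ext (f := fun x => rev (foldl (fun a e => if p x e then e :: a else a) [::] (s x)))).
  move=> x; suff H t u : foldl (fun a (e : A) => if p x e then e :: a else a) u t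
      = rev (filter (p x) t) ++ u by rewrite H cats0 revK.
  by elim: t u => //= e t IH u; rewrite IH; case: ifP => // _; rewrite rev_cons cat_rcons.
apply: PT_rev; apply: (PT_foldl_add (step := fun x a e => if p x e then e :: a else a)
  (b := fun n => n.+1)) => //.
- apply: PT_if; first exact: PT_step2.
    by apply: PT_cons; [apply/PT_snd/PT_id | apply/PT_snd/PT_fst/PT_id].
  by apply/PT_snd/PT_fst/PT_id.
- exact: PT_const.
- by solve_polyb.
- by move=> x a e; case: ifP => _; rewrite ?esize_cons; lia.
Qed.

Lemma PT_all X A (eX : Enc X) (eA : Enc A) (p : X -> A -> bool) (s : X -> seq A) :
  PT (fun z : X * A => p z.1 z.2) -> PT s -> PT (fun x => all (p x) (s x)).
Proof.
move=> pp ps; apply: (PT_ext (f := fun x => foldl (fun a e => a && p x e) true (s x))).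
  move=> x; suff H t u : foldl (fun a (e : A) => a && p x e) u t = u && all (p x) t by rewrite H.
  by elim: t u => [|e t IH] u /=; rewrite ?andbT // IH andbA.
apply: (PT_foldl_add (step := fun x a e => a && p x e) (b := fun n => n.+1)) => //.
- apply: PT_andb; last exact: PT_step2.
  by apply/PT_snd/PT_fst/PT_id.
- exact: PT_const.
- by solve_polyb.
- by move=> x a e; case: a => //=; case: (p x e).
Qed.

Lemma PT_sumn X (eX : Enc X) (s : X -> seq nat) : PT s -> PT (fun x => sumn (s x)).
Proof.
move=> ps; apply: (PT_ext (f := fun x => foldl (fun a e => e + a) 0 (s x))).
  move=> x; suff H t u : foldl (fun a e => e + a) u t = u + sumn t by rewrite H.
  by elim: t u => [|e t IH] u /=; rewrite ?addn0 // IH addnAC addnC addnCA addnC.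
apply: (PT_foldl_add (step := fun _ a e => e + a) (b := fun n => n)) => //.
- by apply: PT_addn; [apply/PT_snd/PT_id | apply/PT_snd/PT_fst/PT_id].
- exact: PT_const.
- by solve_polyb.
- by move=> x a e; have := esize_add e a; lia.
Qed.

Lemma PT_flatten X A (eX : Enc X) (eA : Enc A) (s : X -> seq (seq A)) :
  PT s -> PT (fun x => flatten (s x)).
Proof.
move=> ps; apply: (PT_ext (f := fun x => foldl (fun a e => a ++ e) [::] (s x))).
  move=> x; suff H t u : foldl (fun a (e : seq A) => a ++ e) u t = u ++ flatten t by rewrite H.
  by elim: t u => [|e t IH] u /=; rewrite ?cats0 // IH catA.
apply: (PT_foldl_add (step := fun _ a e => a ++ e) (b := fun n => n)) => //.
- by apply: PT_cat; [apply/PT_snd/PT_fst/PT_id | apply/PT_snd/PT_id].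
- exact: PT_const.
- by solve_polyb.
- by move=> x a e; elim: a => [|u a IH]; rewrite ?cat0s ?cat_cons ?esize_cons; lia.
Qed.

Lemma esize_cat A (eA : Enc A) (s t : seq A) : (esize (s ++ t)).+1 = esize s + esize t.
Proof. by elim: s => [|u s IH]; rewrite ?cat_cons ?esize_cons //; lia. Qed.

Lemma esize_filterC A (eA : Enc A) (p : pred A) (s : seq A) :
  esize (filter p s) + esize (filter (predC p) s) = (esize s).+1.
Proof. by elim: s => // u s IH /=; case: (p u) => /=; rewrite !esize_cons; lia. Qed.

(** Two filters instead of a recursion, so that polynomial time follows from the result on
    [filter]. *)
Definition insert A (le : rel A) (x : A) (s : seq A) :=
  [seq y <- s | le y x] ++ x :: [seq y <- s | ~~ le y x].

Definition isort A (le : rel A) (s : seq A) := foldl (fun a x => insert le x a) [::] s.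

Lemma PT_isort X A (eX : Enc X) (eA : Enc A) (le : X -> rel A) (s : X -> seq A) :
  PT (fun z : X * A * A => le z.1.1 z.1.2 z.2) -> PT s -> PT (fun x => isort (le x) (s x)).
Proof.
move=> pl ps; apply: (PT_foldl_add (step := fun x a e => insert (le x) e a) (b := fun n => n.+1)) => //.
- have ple : PT (fun z : X * seq A * A * A => le z.1.1.1 z.2 z.1.2).
    apply: (PT_comp (f := fun z : X * seq A * A * A => (z.1.1.1, z.2, z.1.2)) _ pl).
    apply: PT_pair; last by apply/PT_snd/PT_fst/PT_id.
    by apply: PT_pair; [apply/PT_fst/PT_fst/PT_fst/PT_id | apply/PT_snd/PT_id].
  apply: PT_cat; last apply: PT_cons; first 1 last.
  + by apply/PT_snd/PT_id.
  + apply: (PT_filter (p := fun (z : X * seq A * A) y => ~~ le z.1.1 y z.2)).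
      exact: PT_negb.
    by apply/PT_snd/PT_fst/PT_id.
  + apply: (PT_filter (p := fun (z : X * seq A * A) y => le z.1.1 y z.2)) => //.
    by apply/PT_snd/PT_fst/PT_id.
- exact: PT_const.
- by solve_polyb.
- move=> x a e; rewrite /insert.
  have := esize_cat eA [seq y <- a | le x y e] (e :: [seq y <- a | ~~ le x y e]).
  have -> : esize a = (esize [seq y <- a | le x y e] + esize [seq y <- a | ~~ le x y e]).-1.
    by rewrite (esize_filterC eA (fun y => le x y e) a).
  rewrite esize_cons; have := esize_gt0 _ [seq y <- a | le x y e].
  have := esize_gt0 _ [seq y <- a | ~~ le x y e]; lia.
Qed.

(** * The algorithm *)

(** The result comes in reverse order, which is harmless since each item records its index. *)
Definition mapi A B (f : nat -> A -> B) (s : seq A) : seq B :=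
  (foldl (fun a e => (a.1.+1, f a.1 e :: a.2)) (0, [::]) s).2.

(** The pairs are nested as in [enc_job], so that the encoding of an instance is also an encoding in
    the sense of [enc]. *)
Definition raw_job := (nat * (nat * (nat * ((nat * nat) * (nat * nat)))))%type.

Definition item := (nat * (nat * nat) * nat * (nat * nat) * (nat * nat))%type.

Definition ident (x : item) := x.1.1.1.1.
Definition lo (x : item) := x.1.1.1.2.1.
Definition len (x : item) := x.1.1.1.2.2.
Definition dur (x : item) := x.1.1.2.
Definition sz (x : item) := x.1.2.1.
Definition vol (x : item) := x.1.2.2.
Definition wnum (x : item) := x.2.1.
Definition wden (x : item) := x.2.2.

(* An aligned dyadic block [a, a + 2^k) of maximal size inside [r, d]: if 2^k is
   the largest power of 2 with 2^k <= d + 1 - r, then a block of size 2^(k-1)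
   always fits. *)
Definition block (r d : nat) : nat * nat :=
  let P := pow2 (d.+1 - r) in
  if (r + P - 1) %/ P * P + P <= d.+1 then ((r + P - 1) %/ P * P, P)
  else ((r + P %/ 2 - 1) %/ (P %/ 2) * (P %/ 2), P %/ 2).

(* Requirements are scaled by a common denominator [D], so that hosts have
   capacity [D]. *)
Definition scale (js : seq raw_job) : nat :=
  foldl (fun a x => a * x.2.2.2.1.2) 1 js.

(* The weight of a job of size [s] in a slot, when hosts have capacity [D]. *)
Definition halfw (D s : nat) := if 2 * s <= D then 2 * s else D.

Definition mk_item (D k : nat) (x : raw_job) : item :=
  (k, block x.1 x.2.1, x.2.2.1,
   (x.2.2.2.1.1 * (D %/ x.2.2.2.1.2),
    x.2.2.1 * halfw D (x.2.2.2.1.1 * (D %/ x.2.2.2.1.2))),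
   x.2.2.2.2).

Definition items (js : seq raw_job) : seq item := mapi (mk_item (scale js)) js.

(** Comparison of the profits per unit of volume, cleared of denominators. *)
Definition denser (x y : item) : bool :=
  wnum y * wden x * vol x <= wnum x * wden y * vol y.

Definition inside (i b : item) : bool :=
  (lo i <= lo b) && (lo b + len b <= lo i + len i).

Definition bvol (B : seq item) (i : item) : nat :=
  sumn [seq vol b | b <- [seq b <- B | inside i b]].

(* Since [k] ranges over all the jobs, this is the bound
   [bvol B i <= D * len i * (m - (m + 1) * lam)] for the largest ratio [lam] of
   [dur k] to [len k], cleared of denominators. *)
Definition admissible (m D : nat) (J B : seq item) : bool :=
  all (fun i => all (fun k =>
    bvol B i * len k + D * m.+1 * dur k * len i <= D * m * len k * len i) J) J.

Definition greedy (m D : nat) (J s : seq item) : seq item :=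
  foldl (fun A j => if admissible m D J (j :: A) then j :: A else A) [::] s.

Definition narrow (D : nat) (x : item) : bool := 2 * sz x <= D.

(* Next fit; the state is (current host, its load), and the list of the pairs
   (host, item).  The host number is capped only to bound its size. *)
Definition pack_step (m D : nat) (a : (nat * nat) * seq (nat * item)) (x : item) :=
  if a.1.2 + sz x <= D then (a.1.1, a.1.2 + sz x, (minn a.1.1 m, x) :: a.2)
  else (a.1.1.+1, sz x, (minn a.1.1.+1 m, x) :: a.2).

(** Wide jobs come first, each on its own host; the narrow ones start in the space left on the last
    of these hosts and go on to new hosts. *)
Definition pack (m D : nat) (C : seq item) :=
  foldl (pack_step m D) (0, 0, [::])
    ([seq x <- C | ~~ narrow D x] ++ [seq x <- C | narrow D x]).

Definition fits (m D : nat) (C : seq item) : bool := (pack m D C).1.1 < m.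

Definition nload (D : nat) (C : seq item) : nat :=
  sumn [seq sz x | x <- [seq x <- C | narrow D x]].

(** A slot without narrow jobs is not preferred: bringing a first narrow job to such a slot is the
    only way to create a bad one. *)
Definition preferred (D : nat) (C : seq item) : bool :=
  (0 < nload D C) && (2 * nload D C < D).

(* [(f, e, C)]: the jobs [C] run in all the slots of [f, e). *)
Definition segment := (nat * nat * seq item)%type.

(** The flag stops the search after one cut, so that for any list the number of segments grows by at
    most one; in a partition one cut is enough. *)
Definition cut_step (p : nat) (a : bool * seq segment) (g : segment) :=
  if a.1 && ((g.1.1 < p) && (p < g.1.2))
  then (false, (g.1.1, p, g.2) :: (p, g.1.2, g.2) :: a.2)
  else (a.1, g :: a.2).

Definition cut (p : nat) (s : seq segment) : seq segment :=
  (foldl (cut_step p) (true, [::]) s).2.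

Definition fill_step (m D : nat) (j : item) (a : nat * seq segment) (g : segment) :=
  if (0 < a.1) && ((lo j <= g.1.1) && ((g.1.2 <= lo j + len j) && fits m D (j :: g.2)))
  then if g.1.2 - g.1.1 <= a.1
       then (a.1 - (g.1.2 - g.1.1), (g.1.1, g.1.2, j :: g.2) :: a.2)
       else (0, (g.1.1, g.1.1 + a.1, j :: g.2) :: (g.1.1 + a.1, g.1.2, g.2) :: a.2)
  else (a.1, g :: a.2).

Definition pref_first (D : nat) (s : seq segment) : seq segment :=
  [seq g <- s | preferred D g.2] ++ [seq g <- s | ~~ preferred D g.2].

Definition place (m D : nat) (s : seq segment) (j : item) : seq segment :=
  (foldl (fill_step m D j) (dur j, [::])
    (pref_first D (cut (lo j + len j) (cut (lo j) s)))).2.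

(** The initial segment contains slot 0 besides the slots up to [T]; windows of valid jobs avoid
    it. *)
Definition sched (m D T : nat) (A : seq item) : seq segment :=
  foldl (place m D) [:: (0, T.+1, [::])] A.

(** Segments are half-open and runs are closed, hence the [- 1]. *)
Definition seg_runs (m D : nat) (g : segment) : seq (nat * (nat * (nat * nat))) :=
  [seq (ident hx.2, (hx.1, (g.1.1, g.1.2 - 1))) | hx <- (pack m D g.2).2].

Definition accepted (m : nat) (js : seq raw_job) : seq item :=
  greedy m (scale js) (items js) (isort denser (items js)).

Definition segments (m T : nat) (js : seq raw_job) : seq segment :=
  sched m (scale js) T (isort (fun x y => len x <= len y) (accepted m js)).

Definition alg (m : nat) (z : nat * (nat * seq raw_job)) :=
  ([seq ident x | x <- accepted m z.2.2],
   flatten [seq seg_runs m (scale z.2.2) g | g <- segments m z.1 z.2.2]).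

(** * Running time of the algorithm *)

Ltac pt_user := fail.

(** Follows the syntax of the function; [pt_user] is a hook that is extended as functions of the
    algorithm get treated. *)
Ltac pt := cbv beta;
  lazymatch goal with
  | |- PT (fun _ => ?c) => apply: PT_const
  | |- PT (@fst _ _) => apply: PT_fst; apply: PT_id
  | |- PT (@snd _ _) => apply: PT_snd; apply: PT_id
  | |- PT (fun x => x) => apply: PT_id
  | |- PT (fun x => (@?f x, @?g x)) => apply: (@PT_pair _ _ _ _ _ _ f g); pt
  | |- PT (fun x => fst (@?f x)) => apply: (@PT_fst _ _ _ _ _ _ f); pt
  | |- PT (fun x => snd (@?f x)) => apply: (@PT_snd _ _ _ _ _ _ f); pt
  | |- PT (fun x => addn (@?f x) (@?g x)) => apply: (@PT_addn _ _ f g); pt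
  | |- PT (fun x => subn (@?f x) (@?g x)) => apply: (@PT_subn _ _ f g); pt
  | |- PT (fun x => muln (@?f x) (@?g x)) => apply: (@PT_muln _ _ f g); pt
  | |- PT (fun x => divn (@?f x) (@?g x)) => apply: (@PT_divn _ _ f g); pt
  | |- PT (fun x => S (@?f x)) => apply: (@PT_succn _ _ f); pt
  | |- PT (fun x => leq (@?f x) (@?g x)) => apply: (@PT_leq _ _ f g); pt
  | |- PT (fun x => andb (@?f x) (@?g x)) => apply: (@PT_andb _ _ f g); pt
  | |- PT (fun x => negb (@?f x)) => apply: (@PT_negb _ _ f); pt
  | |- PT (fun x => pow2 (@?f x)) => apply: (@PT_pow2 _ _ f); pt
  | |- PT (fun x => cons (@?f x) (@?g x)) => apply: (@PT_cons _ _ _ _ f g); pt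
  | |- PT (fun x => cat (@?f x) (@?g x)) => apply: (@PT_cat _ _ _ _ f g); pt
  | |- PT (fun x => sumn (@?f x)) => apply: (@PT_sumn _ _ f); pt
  | |- PT (fun x => flatten (@?f x)) => apply: (@PT_flatten _ _ _ _ f); pt
  | |- PT (fun x => map (@?f x) (@?g x)) => apply: (@PT_map _ _ _ _ _ _ f g); pt
  | |- PT (fun x => filter (@?f x) (@?g x)) => apply: (@PT_filter _ _ _ _ f g); pt
  | |- PT (fun x => all (@?f x) (@?g x)) => apply: (@PT_all _ _ _ _ f g); pt
  | |- PT (fun x => isort (@?f x) (@?g x)) => apply: (@PT_isort _ _ _ _ f g); pt
  | |- _ => first [assumption | pt_user; pt | apply: PT_if; pt | idtac]
  end.

Lemma esize_nat_le n : esize n <= n.+1.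
Proof. by apply: esize_lt => //; apply: ltn_trans (ltn_expl _ (isT : 1 < 2)) _; rewrite ltn_exp2l. Qed.

(** [PT_foldl_add] does not apply, as the size of a new element depends on the counter stored in the
    accumulator; the counter is bounded by the length of the list. *)
Lemma PT_mapi X A B (eX : Enc X) (eA : Enc A) (eB : Enc B) (f : X -> nat -> A -> B) (s : X -> seq A) :
  PT (fun z : X * nat * A => f z.1.1 z.1.2 z.2) -> PT s -> PT (fun x => mapi (f x) (s x)).
Proof.
move=> pf ps; have [kf Hf] := PT_size pf; have [ks Hs] := PT_size ps.
pose stp x (a : nat * seq B) e := (a.1.+1, f x a.1 e :: a.2).
pose b n := let M := (n + 2) ^ ks in M + (M * ((n + M + M + 4) ^ kf + 1)) + 2.
apply: PT_snd; apply: (@PT_foldl _ _ _ _ _ _ stp _ _ b) => //.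
- rewrite /stp; pt.
  apply: (PT_comp (f := fun z : X * (nat * seq B) * A => (z.1.1, z.1.2.1, z.2)) _ pf); pt.
- exact: PT_const.
- by rewrite /b; solve_polyb.
move=> x k; set M := (esize x + 2) ^ ks.
have sM : esize (s x) <= M := Hs x.
set K := (esize x + M + M + 4) ^ kf + 1.
have H : forall (L : seq A) c (u : seq B), c + size L < M -> esize L <= M ->
    esize (foldl (stp x) (c, u) L) <= M + esize u + size L * K + 1.
  elim=> [|e L IH] c u /= cM.
    by move=> _; rewrite esize_pair; have := esize_nat_le c; lia.
  rewrite esize_cons => eM; apply: leq_trans (IH _ _ _ _) _; [by rewrite /=; lia|by lia|].
  rewrite /= esize_cons mulSn.
  have : esize (f x c e) < K.
    rewrite /K addn1 ltnS; apply: leq_trans (Hf (x, c, e)) _; rewrite !esize_pair /=; apply: leq_expl.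
    by have := esize_nat_le c; lia.
  by move: (size L * K) => p; lia.
have sk : size (take k (s x)) < M.
  apply: leq_trans (leq_trans (size_esize _ _) sM); rewrite ltnS size_take.
  by case: ltnP => // /ltnW.
apply: leq_trans (H _ _ _ _ _) _ => //; first exact: leq_trans (esize_take _ _ _) sM.
rewrite /b -/M -/K -[esize [::]]/1.
have : size (take k (s x)) * K <= M * K by rewrite leq_mul2r (ltnW sk) orbT.
lia.
Qed.

Lemma PT_lift2 A B C (eA : Enc A) (eB : Enc B) (eC : Enc C) (F : A -> B -> C) :
  PT (fun z : A * B => F z.1 z.2) ->
  forall X (eX : Enc X) (f : X -> A) (g : X -> B), PT f -> PT g ->
  PT (fun x => F (f x) (g x)).
Proof. by move=> pF X eX f g pf pg; apply: PT_comp (PT_pair pf pg) pF. Qed.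

Lemma PT_lift3 A B C D (eA : Enc A) (eB : Enc B) (eC : Enc C) (eD : Enc D)
    (F : A -> B -> C -> D) :
  PT (fun z : A * B * C => F z.1.1 z.1.2 z.2) ->
  forall X (eX : Enc X) (f : X -> A) (g : X -> B) (h : X -> C), PT f -> PT g -> PT h ->
  PT (fun x => F (f x) (g x) (h x)).
Proof.
by move=> pF X eX f g h pf pg ph; apply: PT_comp (PT_pair (PT_pair pf pg) ph) pF.
Qed.

Lemma PT_bvol X (eX : Enc X) (B : X -> seq item) (i : X -> item) :
  PT B -> PT i -> PT (fun x => bvol (B x) (i x)).
Proof. by move: X eX B i; apply: (PT_lift2 (F := bvol)); rewrite /bvol /inside /lo /len /vol; pt. Qed.

Lemma PT_narrow X (eX : Enc X) (D : X -> nat) (i : X -> item) :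
  PT D -> PT i -> PT (fun x => narrow (D x) (i x)).
Proof. by move: X eX D i; apply: (PT_lift2 (F := narrow)); rewrite /narrow /sz; pt. Qed.

Ltac pt_user ::= first [apply: PT_bvol | apply: PT_narrow].

Lemma esize_fst A B (eA : Enc A) (eB : Enc B) (x : A * B) : esize x.1 < esize x.
Proof. by case: x => a b; rewrite esize_pair ltnS leq_addr. Qed.

Lemma esize_snd A B (eA : Enc A) (eB : Enc B) (x : A * B) : esize x.2 < esize x.
Proof. by case: x => a b; rewrite esize_pair ltnS leq_addl. Qed.

Lemma esize_sz (x : item) : esize (sz x) <= esize x.
Proof.
by apply: leq_trans (ltnW (esize_fst _ _ _)); apply: leq_trans (ltnW (esize_snd _ _ _));
  apply: ltnW; apply: esize_fst.
Qed.

Lemma PT_pack m X (eX : Enc X) (D : X -> nat) (C : X -> seq item) :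
  PT D -> PT C -> PT (fun x => pack m (D x) (C x)).
Proof.
move: X eX D C; apply: (PT_lift2 (F := pack m)); rewrite /pack.
apply: (PT_foldl_add (step := fun z => pack_step m z.1)
   (i := fun=> (0, 0, [::])) (b := fun n => 3 * n + 2 * esize m + 20)).
- rewrite /pack_step /minn /sz; pt.
- pt.
- pt.
- by solve_polyb.
move=> [D C] [[h l] out] x; rewrite /pack_step /=.
have mh k : esize (minn k m) <= esize m by apply/esize_le/geq_minr.
have := esize_add l (sz x); have := esize_sz x; have := esize_gt0 _ l.
have := esize_add h 1; rewrite -[esize 1]/1 addn1.
case: ifP => _; rewrite !(esize_pair, esize_cons) /=.
  by have := mh h; lia.
by have := mh h.+1; lia.
Qed.

Lemma PT_fits m X (eX : Enc X) (D : X -> nat) (C : X -> seq item) :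
  PT D -> PT C -> PT (fun x => fits m (D x) (C x)).
Proof.
move: X eX D C; apply: (PT_lift2 (F := fits m)); rewrite /fits; pt.
apply: PT_pack; pt.
Qed.

Lemma PT_preferred X (eX : Enc X) (D : X -> nat) (C : X -> seq item) :
  PT D -> PT C -> PT (fun x => preferred (D x) (C x)).
Proof.
by move: X eX D C; apply: (PT_lift2 (F := preferred)); rewrite /preferred /nload /sz; pt.
Qed.

Ltac pt_user ::= first [apply: PT_bvol | apply: PT_narrow | apply: PT_pack | apply: PT_fits |
  apply: PT_preferred].

Lemma PT_pref_first X (eX : Enc X) (D : X -> nat) (s : X -> seq segment) :
  PT D -> PT s -> PT (fun x => pref_first (D x) (s x)).
Proof.
by move: X eX D s; apply: (PT_lift2 (F := pref_first)); rewrite /pref_first; pt.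
Qed.

Lemma PT_cut X (eX : Enc X) (p : X -> nat) (s : X -> seq segment) :
  PT p -> PT s -> PT (fun x => cut (p x) (s x)).
Proof.
move: X eX p s; apply: (PT_lift2 (F := cut)); rewrite /cut; apply: PT_snd.
apply: (PT_foldl_add (step := fun z => cut_step z.1) (i := fun=> (true, [::]))
  (b := fun n => 3 * n + 10)).
- by rewrite /cut_step; pt.
- pt.
- pt.
- by solve_polyb.
move=> [p s] [fl out] [[f e] C]; rewrite /cut_step /=.
by case: ifP => _; rewrite !(esize_pair, esize_cons) /=; have := esize_gt0 _ fl;
  rewrite -?[esize false]/1; lia.
Qed.

Lemma PT_place m X (eX : Enc X) (D : X -> nat) (s : X -> seq segment) (j : X -> item) :
  PT D -> PT s -> PT j -> PT (fun x => place m (D x) (s x) (j x)).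
Proof.
move: X eX D s j; apply: (PT_lift3 (F := place m)); rewrite /place; apply: PT_snd.
apply: (PT_foldl_add (step := fun z => fill_step m z.1.1 z.2) (i := fun z => (dur z.2, [::]))
  (b := fun n => 6 * n + 20)).
- by rewrite /fill_step /lo /len; pt.
- by rewrite /dur; pt.
- apply: PT_pref_first; first pt.
  by rewrite /lo /len; apply: PT_cut; [pt | apply: PT_cut; pt].
- by solve_polyb.
move=> [[D s] j] [r out] [[f e] C]; rewrite /fill_step /=.
case: ifP => _; last by rewrite !(esize_pair, esize_cons) /=; lia.
case: ifP => er; rewrite !(esize_pair, esize_cons) /=.
  have := esize_le (leq_subr (e - f) r); lia.
have fre : f + r <= e by lia.
have := esize_le fre; rewrite -[esize 0]/1; lia.
Qed.

Lemma esize_seq_le A (eA : Enc A) (s : seq A) K :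
  all (fun x => esize x <= K) s -> esize s <= size s * K.+1 + 1.
Proof. by elim: s => // x s IH /= /andP[xK /IH]; rewrite esize_cons; lia. Qed.

(** Splitting a segment duplicates its content, so the growth of a schedule is not additive. Its
    size is controlled instead by the end points, the number of jobs per segment and the number of
    segments. *)
Definition seg_le (T M c : nat) (g : segment) : bool :=
  [&& g.1.1 <= T, g.1.2 <= T, size g.2 <= c & all (fun x => esize x <= M) g.2].

Lemma all_cut T M c p s : all (seg_le T M c) s -> all (seg_le T M c) (cut p s).
Proof.
rewrite /cut => ok; have : all (seg_le T M c) ([::] : seq segment) by [].
elim: s true ([::] : seq segment) ok => //= -[[f e] C] s IH fl out /andP[okg oks] oko.
rewrite {2}/cut_step /=; case: ifP => [/and3P[_ fp pe]|_]; apply: IH => //=; rewrite ?okg //.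
move: okg; rewrite /seg_le /= oko => /and4P[fT eT -> ->].
by rewrite fT eT (leq_trans (ltnW pe) eT).
Qed.

Lemma size_cut p s : size (cut p s) <= (size s).+1.
Proof.
suff H fl out : size (foldl (cut_step p) (fl, out) s).2 <= size out + size s + fl.
  by apply: leq_trans (H _ _) _; rewrite addn1.
elim: s fl out => /= [|g s IH] fl out; first by rewrite addn0 leq_addr.
rewrite {2}/cut_step /=; case: ifP => [/andP[-> _]|_]; apply: leq_trans (IH _ _) _ => /=; lia.
Qed.

Lemma size_pref_first D s : size (pref_first D s) = size s.
Proof.
by rewrite size_cat !size_filter -(count_predC (fun g => preferred D g.2) s).
Qed.

Lemma all_pref_first D p s : all p (pref_first D s) = all p s.
Proof.
rewrite all_cat; elim: s => //= g s <-; case: (preferred D g.2) => /=; first by rewrite andbA.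
by rewrite andbCA.
Qed.

Lemma all_fill T M c m D j a s : esize j <= M -> all (seg_le T M c) s ->
  all (seg_le T M c.+1) a.2 -> all (seg_le T M c.+1) (foldl (fill_step m D j) a s).2.
Proof.
move=> jM; elim: s a => // -[[f e] C] s IH [r out] /= /andP[okg oks] oko.
apply: IH => //; rewrite /fill_step /=; move: okg; rewrite /seg_le /= => /and4P[fT eT sC aC].
have sC' := leqW sC.
case: ifP => _ /=; last by rewrite fT eT sC' aC.
case: ifP => er /=; first by rewrite fT eT ltnS sC jM aC.
rewrite fT eT ltnS sC jM aC sC' oko !andbT /=; lia.
Qed.

Lemma size_fill m D j a s :
  size (foldl (fill_step m D j) a s).2 <= size a.2 + size s + (0 < a.1).
Proof.
elim: s a => /= [|g s IH] [r out]; first by rewrite addn0 leq_addr.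
apply: leq_trans (IH _) _; rewrite /fill_step /=.
case: ifP => [/andP[r0 _]|_] /=; last by lia.
by case: ifP => _ /=; lia.
Qed.

(** Each of the two cuts, and the split of the last segment used, adds at most one segment. *)
Lemma place_le T M c m D s j : esize j <= M -> all (seg_le T M c) s ->
  all (seg_le T M c.+1) (place m D s j) /\ size (place m D s j) <= size s + 3.
Proof.
move=> jM ok; split.
  by apply: all_fill => //; rewrite all_pref_first; do 2!apply: all_cut.
apply: leq_trans (size_fill _ _ _ _ _) _; rewrite size_pref_first /=.
have := size_cut (lo j + len j) (cut (lo j) s); have := size_cut (lo j) s; lia.
Qed.

Lemma all_esize A (eA : Enc A) (s : seq A) : all (fun x => esize x <= esize s) s.
Proof.
elim: s => //= x s IH; rewrite esize_cons; apply/andP; split; first by lia.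
by apply: sub_all IH => y; lia.
Qed.

Lemma PT_sched m X (eX : Enc X) (D T : X -> nat) (A : X -> seq item) :
  PT D -> PT T -> PT A -> PT (fun x => sched m (D x) (T x) (A x)).
Proof.
move: X eX D T A; apply: (PT_lift3 (F := sched m)); rewrite /sched.
apply: (PT_foldl (step := fun z => place m z.1.1) (i := fun z => [:: (0, z.1.2.+1, [::])])
  (b := fun n => (1 + 3 * n) * ((2 * (n + 1) + n * (n + 1) + 3) + 1) + 1)).
- by apply: PT_place; pt.
- by pt.
- by pt.
- by solve_polyb.
move=> [[D T] A] k /=; set M := esize A.
have inv : forall L c s, all (fun x => esize x <= M) L -> all (seg_le T.+1 M c) s ->
    all (seg_le T.+1 M (c + size L)) (foldl (place m D) s L) /\
    size (foldl (place m D) s L) <= size s + 3 * size L.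
  elim=> [|j L IH] c s /=; first by rewrite addn0 muln0 addn0.
  move=> /andP[jM LM] ok; have [ok1 sz1] := place_le m D jM ok.
  have [ok2 sz2] := IH _ _ LM ok1; rewrite addnS -addSn; split=> //; lia.
have LM : all (fun x => esize x <= M) (take k A).
  by apply/allP => x /mem_take; move: x; apply/allP; apply: all_esize.
have [||ok sz] := inv (take k A) 0 [:: (0, T.+1, [::])]; first exact: LM.
  by rewrite /= /seg_le /= leqnn.
have sk : size (take k A) <= M.
  apply: leq_trans (ltnW (size_esize _ A)); rewrite size_take.
  by case: ltnP => // /ltnW.
rewrite esize_pair [esize (D, T)]esize_pair -/M; set n := (_ + M).+1.
have Mn : M <= n by rewrite /n; lia.
have Tn : esize T <= n by rewrite /n; lia.
have gK : all (fun g => esize g <= 2 * (n + 1) + n * (n + 1) + 3)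
    (foldl (place m D) [:: (0, T.+1, [::])] (take k A)).
  apply: sub_all ok => -[[f e] C] /and4P[/= fT eT sC aC].
  rewrite esize_pair [esize (f, e)]esize_pair.
  have := esize_le fT; have := esize_le eT; have := esize_add T 1.
  rewrite addn1 -[esize 1]/1 => T1 e1 f1.
  have C1 := esize_seq_le aC.
  have : size C * M.+1 <= n * (n + 1).
    by rewrite addn1; apply: leq_mul => //; apply: leq_trans sC (leq_trans sk Mn).
  lia.
apply: leq_trans (esize_seq_le gK) _; rewrite leq_add2r.
apply: leq_mul; last by rewrite [X in _ <= X]addn1.
apply: leq_trans sz _; rewrite /= leq_add2l leq_mul2l /=; exact: leq_trans sk Mn.
Qed.

Lemma PT_scale X (eX : Enc X) (s : X -> seq raw_job) : PT s -> PT (fun x => scale (s x)).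
Proof.
move=> ps; apply: (PT_comp ps (g := scale)); rewrite /scale.
apply: (PT_foldl_add (step := fun _ a (x : raw_job) => a * x.2.2.2.1.2) (i := fun=> 1)
  (b := fun n => n)).
- by pt.
- by pt.
- by pt.
- by solve_polyb.
move=> x a e; apply: leq_trans (esize_mul _ _) _; rewrite leq_add2l.
apply: leq_trans (leq_addl _ _).
have sn B C (eB : Enc B) (eC : Enc C) (z : B * C) : esize z.2 <= esize z by apply/ltnW/esize_snd.
have fs B C (eB : Enc B) (eC : Enc C) (z : B * C) : esize z.1 <= esize z by apply/ltnW/esize_fst.
apply: leq_trans (sn _ _ _ _ e.2.2.2.1) _; apply: leq_trans (fs _ _ _ _ e.2.2.2) _.
by apply: leq_trans (sn _ _ _ _ e.2.2) _; apply: leq_trans (sn _ _ _ _ e.2) _; apply: sn.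
Qed.

Lemma PT_block X (eX : Enc X) (r d : X -> nat) : PT r -> PT d -> PT (fun x => block (r x) (d x)).
Proof. by move: X eX r d; apply: (PT_lift2 (F := block)); rewrite /block; pt. Qed.

Lemma PT_halfw X (eX : Enc X) (r d : X -> nat) : PT r -> PT d -> PT (fun x => halfw (r x) (d x)).
Proof. by move: X eX r d; apply: (PT_lift2 (F := halfw)); rewrite /halfw; pt. Qed.

Ltac pt_user ::= first [apply: PT_bvol | apply: PT_narrow | apply: PT_pack | apply: PT_fits |
  apply: PT_preferred | apply: PT_scale | apply: PT_block | apply: PT_halfw].

Lemma PT_items X (eX : Enc X) (s : X -> seq raw_job) : PT s -> PT (fun x => items (s x)).
Proof.
move=> ps; apply: (PT_comp ps (g := items)).
apply: (PT_mapi (f := fun js => mk_item (scale js))); last by pt.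
by rewrite /mk_item; pt.
Qed.

Lemma PT_greedy m X (eX : Enc X) (D : X -> nat) (J s : X -> seq item) :
  PT D -> PT J -> PT s -> PT (fun x => greedy m (D x) (J x) (s x)).
Proof.
move: X eX D J s; apply: (PT_lift3 (F := greedy m)); rewrite /greedy.
apply: (PT_foldl_add (i := fun=> [::]) (b := fun n => n.+1)
  (step := fun z A j => if admissible m z.1.1 z.1.2 (j :: A) then j :: A else A)).
- by rewrite /admissible /len /dur; pt.
- by pt.
- by pt.
- by solve_polyb.
by move=> x a e; case: ifP => _; rewrite ?esize_cons; lia.
Qed.

Lemma PT_accepted m X (eX : Enc X) (s : X -> seq raw_job) :
  PT s -> PT (fun x => accepted m (s x)).
Proof.
move=> ps; apply: (PT_comp ps (g := accepted m)); rewrite /accepted.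
have pi : PT items by apply: PT_items; apply: PT_id.
apply: PT_greedy; [by pt | exact: pi | apply: (PT_isort (le := fun _ => denser)) => //].
by rewrite /denser /wnum /wden /vol; pt.
Qed.

Lemma PT_alg m : PT (alg m).
Proof.
have pa : PT (fun z : nat * (nat * seq raw_job) => accepted m z.2.2) by apply: PT_accepted; pt.
apply: PT_pair; first by rewrite /ident; pt.
apply: PT_flatten; apply: (PT_map (f := fun z => seg_runs m (scale z.2.2))).
  by rewrite /seg_runs /ident; pt.
rewrite /segments; apply: PT_sched; [by pt | by pt |].
by apply: (PT_isort (le := fun _ x y => len x <= len y)) => //; rewrite /len; pt.
Qed.

(** * Packing a slot *)

Section Pack.
Variables m D : nat.
Hypothesis m_gt0 : 0 < m.
Implicit Types (C L : seq item) (x j : item).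

Definition sz_ok x := 0 < sz x <= D.
Definition nwide C := count (fun x => ~~ narrow D x) C.
Definition weight C := sumn [seq halfw D (sz x) | x <- C].
(* A slot that may reject a wide job although it weighs less than [m * D]. *)
Definition bad C := preferred D C && (nwide C < m).

Lemma weightE C : weight C = nwide C * D + 2 * nload D C.
Proof.
rewrite /weight /nload /nwide; elim: C => //= x C ->; rewrite /narrow /halfw.
by case: ifP => _ /=; lia.
Qed.

Lemma nload_cons x C : nload D (x :: C) = (if narrow D x then sz x else 0) + nload D C.
Proof. by rewrite /nload /=; case: ifP. Qed.

(** Two wide jobs exceed the capacity, so each one opens a new host and leaves it more than half
    full. *)
Lemma pack_wide L a : all sz_ok L -> all (fun x => ~~ narrow D x) L ->
  D < 2 * a.1.2 ->
  let r := foldl (pack_step m D) a L in r.1.1 = a.1.1 + size L /\ D < 2 * r.1.2.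
Proof.
elim: L a => [|x L IH] a /=; first by rewrite addn0.
move=> /andP[_ Lok] /andP[xw Lw] aD.
have -> : pack_step m D a x = (a.1.1.+1, sz x, (minn a.1.1.+1 m, x) :: a.2).
  by rewrite /pack_step ifF //; move: xw; rewrite /narrow; lia.
have [|-> ?] := IH (a.1.1.+1, sz x, (minn a.1.1.+1 m, x) :: a.2) Lok Lw.
  by move: xw; rewrite /narrow /=; lia.
by rewrite addnS.
Qed.

(* A closed host opened for narrow jobs is more than half full, and together with
   the job that did not fit in it, it is more than full. *)
Lemma pack_narrow L a k y : all sz_ok L -> all (narrow D) L ->
  (a.1.1 + 1 = k) \/ (exists q, [/\ a.1.1 = k + q, q * D + 2 * a.1.2 <= 2 * y,
     0 < q -> (q + 1) * D < 2 * y & 0 < k -> 0 < y]) ->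
  let r := foldl (pack_step m D) a L in
  let y' := y + sumn [seq sz x | x <- L] in
  (r.1.1 + 1 = k) \/ (exists q, [/\ r.1.1 = k + q, q * D + 2 * r.1.2 <= 2 * y',
     0 < q -> (q + 1) * D < 2 * y' & 0 < k -> 0 < y']).
Proof.
elim: L a y => [|x L IH] a y /=; first by rewrite addn0.
move=> /andP[/andP[x0 xD] Lok] /andP[xn Ln] H; rewrite addnA; apply: IH => //.
rewrite /pack_step; case: ifP => ax /=; case: H => [H|[q [H1 H2 H3 H4]]].
- by left.
- by right; exists q; split => //; [lia | move=> /H3; lia | lia].
- by right; exists 0; split; lia.
- right; exists q.+1; move: xn; rewrite /narrow => xn; split; try lia.
Qed.

Lemma filter_sz_ok p C : all sz_ok C -> all sz_ok [seq x <- C | p x].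
Proof. by move=> /allP H; apply/allP => x; rewrite mem_filter => /andP[_ /H]. Qed.

(** If at least two hosts are opened for narrow jobs, these jobs weigh more than [D] times the
    number of such hosts, so that using more than [m] hosts takes a total weight above [m.+1 * D].
    If at most one is opened, the conditions on [nwide] suffice. *)
Lemma fits_suff C : all sz_ok C -> nwide C <= m -> (0 < nload D C -> nwide C < m) ->
  nwide C * D + 2 * nload D C <= m.+1 * D -> fits m D C.
Proof.
move=> Cok wm ywm yD; rewrite /fits /pack foldl_cat.
set a := foldl _ _ [seq x <- C | ~~ _ x].
have nwE : nwide C = size [seq x <- C | ~~ narrow D x] by rewrite size_filter.
have Ha : (a.1.1 + 1 = nwide C) \/ (exists q, [/\ a.1.1 = nwide C + q, q * D + 2 * a.1.2 <= 2 * 0,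
     0 < q -> (q + 1) * D < 2 * 0 & 0 < nwide C -> 0 < 0]).
  rewrite nwE /a; have := filter_sz_ok (fun x => ~~ narrow D x) Cok.
  have := filter_all (fun x => ~~ narrow D x) C.
  case: [seq x <- C | ~~ _ x] => [|x L] /=; first by right; exists 0.
  move=> /andP[xw Lw] /andP[/andP[x0 xD] Lok]; left.
  rewrite [pack_step _ _ _ x]/pack_step /= add0n xD.
  have [|-> _] := pack_wide (a := (0, sz x, [:: (minn 0 m, x)])) Lok Lw.
    by move: xw; rewrite /narrow /=; lia.
  by rewrite add0n addn1.
have := pack_narrow (filter_sz_ok (narrow D) Cok) (filter_all _ _) Ha.
rewrite /= add0n -/(nload D C) => -[|[q [-> H2 H3 H4]]]; first by lia.
case: (posnP q) => [q0|/H3 {H3}H3].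
  by move: wm H2 H4 ywm; rewrite q0 addn0; case: (posnP (nwide C)) => [->|k0]; lia.
rewrite ltnNge; apply/negP => mq.
have : m.+1 * D <= (nwide C + q + 1) * D by rewrite leq_mul2r addn1 ltnS mq orbT.
by rewrite -addnA mulnDl; lia.
Qed.

(** One job adds at most [D], so below weight [m * D] the weight condition of [fits_suff] survives.
    Only its condition on wide jobs can fail: [j] is wide and joins [m - 1] wide jobs and some
    narrow ones, which then weigh less than [D], and the slot is bad. *)
Lemma unfit_weight j C : sz_ok j -> all sz_ok C -> ~~ fits m D (j :: C) ->
  m * D <= weight C + bad C * D.
Proof.
move=> jok Cok /negP nf; rewrite weightE leqNgt; apply/negP => lt; apply: nf.
apply: fits_suff; first by rewrite /= jok.
all: move: lt; rewrite ?nload_cons /nwide /= -/(nwide C) /bad /preferred.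
all: move/andP: jok => [j0 jD]; case: (boolP (narrow D j)); rewrite /narrow /= => jn.
all: move: (nwide C) (nload D C) => w y.
- move=> lt; have : w < m by rewrite ltnNge; apply/negP => mw; have := leq_mul mw (leqnn D); lia.
  by lia.
- move=> lt; have : w < m by rewrite ltnNge; apply/negP => mw; have := leq_mul mw (leqnn D); lia.
  by lia.
- move=> lt _; have : w < m by rewrite ltnNge; apply/negP => mw; have := leq_mul mw (leqnn D); lia.
  by lia.
- move=> lt; rewrite !add0n => y0.
  have wm : w < m by rewrite ltnNge; apply/negP => mw; have := leq_mul mw (leqnn D); lia.
  rewrite ltn_neqAle add1n wm andbT; apply/eqP => wm1; move: lt; rewrite y0 wm /= andbT -wm1.
  by case: (ltnP (2 * y) D) => /=; lia.
- by move=> lt; lia.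
- move=> lt; have : w * D + 2 * y < m * D by lia.
  by lia.
Qed.

(** Together with [j], the narrow jobs weigh less than [2 * D], next to at most [m - 1] wide ones:
    bad slots can only reject wide jobs. *)
Lemma bad_fits j C : sz_ok j -> all sz_ok C -> narrow D j -> bad C -> fits m D (j :: C).
Proof.
move=> jok Cok jn /andP[/andP[y0 yD] wm]; apply: fits_suff; first by rewrite /= jok.
all: move: wm; rewrite ?nload_cons /nwide /= jn -/(nwide C) /=; move: jn; rewrite /narrow; try lia.
move=> jn wm; have : (nwide C).+1 * D <= m * D by rewrite leq_mul2r wm orbT.
by lia.
Qed.

Lemma bad_cons_narrow j C : narrow D j -> bad (j :: C) -> preferred D C -> bad C.
Proof. by move=> jn /andP[_]; rewrite /bad /nwide /= jn add0n => -> ->. Qed.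

Lemma bad_cons_wide j C : ~~ narrow D j -> bad (j :: C) -> bad C.
Proof.
rewrite /bad /preferred nload_cons /nwide /= => jw; rewrite (negbTE jw) /= add0n add1n.
by move=> /andP[-> /ltnW ->].
Qed.

(** The cap on host numbers merges only hosts from [m] on, so the loads below [m] are the true ones,
    and [fits] says that no further host was opened. *)
Lemma pack_spec C : all sz_ok C -> fits m D C ->
  [/\ perm_eq [seq hx.2 | hx <- (pack m D C).2] C,
      all (fun hx => hx.1 < m) (pack m D C).2 &
      forall i, i < m -> sumn [seq sz hx.2 | hx <- (pack m D C).2 & hx.1 == i] <= D].
Proof.
move=> Cok; rewrite /fits /pack; set L := _ ++ _.
have LC : perm_eq L C by rewrite /L perm_catC; apply/permPl; exact: perm_filterC.
have Lok : all sz_ok L by rewrite (perm_all _ LC).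
have inv M (a : nat * nat * seq (nat * item)) : all sz_ok M -> a.1.2 <= D ->
  all (fun hx => hx.1 <= a.1.1) a.2 ->
  (forall i, i < m -> let u := sumn [seq sz hx.2 | hx <- a.2 & hx.1 == i] in
     if i == a.1.1 then u = a.1.2 else u <= D) ->
  let r := foldl (pack_step m D) a M in
  [/\ perm_eq [seq hx.2 | hx <- r.2] (M ++ [seq hx.2 | hx <- a.2]),
     all (fun hx => hx.1 <= r.1.1) r.2 &
     forall i, i < m -> sumn [seq sz hx.2 | hx <- r.2 & hx.1 == i] <= D].
  elim: M a => [|x M IH] [[h l] out] /=.
    move=> _ lD okh H; split=> // i im; have := H i im; case: ifP => //= _ ->//.
  move=> /andP[/andP[x0 xD] Mok] lD okh H.
  have hne i : i < m -> all (fun hx : nat * item => hx.1 <= h) out -> h < i ->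
     sumn [seq sz hx.2 | hx <- out & hx.1 == i] = 0.
    move=> _ okh' hi; rewrite (eq_in_filter (a2 := pred0)) ?filter_pred0 // => hx /(allP okh') /=.
    by move=> ?; apply/negbTE; rewrite neq_ltn; apply/orP; left; lia.
  have stp := IH (pack_step m D (h, l, out) x) Mok.
  have [|||H1 H2 H3] := stp; rewrite /pack_step /=.
  - by case: ifP.
  - case: ifP => _ /=; rewrite geq_minl /= //.
    by apply: sub_all okh => hx; apply: leqW.
  - move=> i im; have := H i im; case: (boolP (l + sz x <= D)) => lx /=.
      have -> : (minn h m == i) = (i == h) by lia.
      by case: eqP => [_ /= ->|_ //]; rewrite addnC.
    have -> : (minn h.+1 m == i) = (i == h.+1) by lia.
    case: (i =P h.+1) => [ih _ /=|_]; first by rewrite hne ?addn0 // ih.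
    by case: eqP => // _ ->.
  - split=> //; apply: perm_trans H1 _; rewrite /pack_step; case: ifP => _ /=; by rewrite -cat1s perm_catCA.
have [//|//|i im|] := inv L (0, 0, [::]) Lok.
  by rewrite /=; case: eqP.
rewrite /= cats0 => H1 H2 H3 fm; split=> //; first exact: perm_trans H1 LC.
by apply: sub_all H2 => hx; move: fm => /[swap]; apply: leq_ltn_trans.
Qed.

End Pack.

(** * Segments *)

Definition cov (t : nat) (g : segment) : bool := g.1.1 <= t < g.1.2.
(** Counting describes the content of a slot independently of the order of the segments, which each
    pass over the list permutes. *)
Definition nseg (s : seq segment) t (P : pred (seq item)) : nat :=
  count (fun g => cov t g && P g.2) s.
Definition wf T (s : seq segment) : Prop :=
  all (fun g => g.1.1 < g.1.2) s /\ forall t, nseg s t predT = (t < T).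
Definition cont (s : seq segment) t : seq item := head [::] [seq g.2 | g <- s & cov t g].

Lemma nseg_cons g s t P : nseg (g :: s) t P = (cov t g && P g.2) + nseg s t P.
Proof. by []. Qed.

Lemma nseg_cat s1 s2 t P : nseg (s1 ++ s2) t P = nseg s1 t P + nseg s2 t P.
Proof. exact: count_cat. Qed.

Lemma nseg_perm s1 s2 t P : perm_eq s1 s2 -> nseg s1 t P = nseg s2 t P.
Proof. by rewrite /nseg => /permP ->. Qed.

Lemma nseg_predT s t : nseg s t predT = count (cov t) s.
Proof. by rewrite /nseg; apply: eq_count => g /=; rewrite andbT. Qed.

Lemma nseg_cont T s t P : wf T s -> nseg s t P = (t < T) && P (cont s t).
Proof.
move=> [_ /(_ t)]; rewrite nseg_predT /cont /nseg.
have -> : count (fun g => cov t g && P g.2) s = count (fun g => P g.2) [seq g <- s | cov t g].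
  by rewrite count_filter; apply: eq_count => g /=; rewrite andbC.
rewrite -size_filter.
by case: [seq g <- s | cov t g] => [|g [|g' u]] /=; case: (t < T) => //=; case: (P _).
Qed.

Lemma cont_eq T s t C : wf T s -> t < T -> (forall P, nseg s t P = P C) -> cont s t = C.
Proof.
by move=> ws tT /(_ (pred1 C)); rewrite (nseg_cont _ _ ws) tT /= eqxx; case: eqP.
Qed.

Lemma cont_out T s t : wf T s -> T <= t -> cont s t = [::].
Proof.
move=> [_ /(_ t)] + Tt; rewrite ltnNge Tt nseg_predT /cont -size_filter.
by case: [seq g <- s | cov t g].
Qed.

Lemma cont_mem T s t g : wf T s -> g \in s -> cov t g -> cont s t = g.2.
Proof.
move=> [_ /(_ t)]; rewrite nseg_predT /cont -size_filter => + gs gt.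
have : g \in [seq g <- s | cov t g] by rewrite mem_filter gt.
case: [seq g <- s | cov t g] => [|g1 [|g2 u]] //=; first by rewrite inE => /eqP ->.
by case: (t < T).
Qed.

Definition straddles (p : nat) (g : segment) : bool := g.1.1 < p < g.1.2.

Lemma nseg_cut p s t P : nseg (cut p s) t P = nseg s t P.
Proof.
rewrite /cut; have -> : nseg s t P = nseg s t P + nseg [::] t P by rewrite addn0.
elim: s true [::] => [|[[f e] C] s IH] fl out //=.
rewrite {2}/cut_step /=; case: ifP => [/and3P[_ fp pe]|_]; rewrite IH /nseg /=; last by lia.
rewrite /cov /=; case: (P C); rewrite ?andbT ?andbF //; lia.
Qed.

Lemma all_cut_straddle q p s : all (fun g => ~~ straddles q g) s ->
  all (fun g => ~~ straddles q g) (cut p s).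
Proof.
rewrite /cut => ok; have : all (fun g => ~~ straddles q g) [::] by [].
elim: s true [::] ok => [|[[f e] C] s IH] fl out //= /andP[ok oks] oko.
rewrite {2}/cut_step /=; case: ifP => [/and3P[_ fp pe]|_]; apply: IH; rewrite //= ?ok ?oko ?andbT //.
by move: ok; rewrite /straddles /=; lia.
Qed.

Lemma all_cut_ne p s : all (fun g => g.1.1 < g.1.2) s -> all (fun g => g.1.1 < g.1.2) (cut p s).
Proof.
rewrite /cut => ok; have : all (fun g : segment => g.1.1 < g.1.2) [::] by [].
elim: s true [::] ok => [|[[f e] C] s IH] fl out //= /andP[ok oks] oko.
rewrite {2}/cut_step /=; case: ifP => [/and3P[_ fp pe]|_]; apply: IH; rewrite //= ?ok ?oko ?andbT //.
by rewrite fp pe.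
Qed.

(** A straddling segment covers [p], and at most one segment of a partition does. *)
Lemma cut_straddle T p s : wf T s -> all (fun g => ~~ straddles p g) (cut p s).
Proof.
move=> [_ /(_ p)]; rewrite nseg_predT => cs.
have st1 : count (straddles p) s <= true.
  apply: leq_trans (_ : count (cov p) s <= _); last by rewrite cs leq_b1.
  by apply: sub_count => g; rewrite /straddles /cov => /andP[/ltnW -> ->].
rewrite /cut; have : all (fun g => ~~ straddles p g) [::] by [].
elim: s true [::] st1 {cs} => [|[[f e] C] s IH] fl out //= st oko.
rewrite {2}/cut_step /=; case: ifP => [/and3P[flt fp pe]|nst]; apply: IH.
- by move: st; rewrite /straddles /= fp pe flt; lia.
- by rewrite /= oko /straddles /= !ltnn !andbF.
- by apply: leq_trans st; rewrite leq_addl.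
- rewrite /= oko andbT; apply/negP => sg; move: st nst; rewrite sg.
  by move: sg; rewrite /straddles /= => /andP[-> ->]; case: fl.
Qed.

Lemma wf_cut T p s : wf T s -> wf T (cut p s).
Proof. by move=> [ne ws]; split=> [|t]; [apply: all_cut_ne | rewrite nseg_cut]. Qed.

Definition measure (s : seq segment) := sumn [seq g.1.2 - g.1.1 | g <- s].

Definition available m D j (g : segment) : bool :=
  (lo j <= g.1.1) && ((g.1.2 <= lo j + len j) && fits m D (j :: g.2)).

(* [tk]: the pieces of segments in which [j] is run, [rs]: the other ones. *)
Lemma fill_spec m D j a s : all (fun g => g.1.1 < g.1.2) s ->
  let r := foldl (fill_step m D j) a s in
  exists tk rs,
    [/\ perm_eq r.2 ([seq (g.1, j :: g.2) | g <- tk] ++ rs ++ a.2),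
        forall t P, nseg s t P = nseg tk t P + nseg rs t P,
        all (fun g => g.1.1 < g.1.2) (tk ++ rs) /\ all (available m D j) tk,
        measure tk + r.1 = a.1 &
        (0 < r.1 -> all (fun g => ~~ available m D j g) rs) /\
        forall P : pred segment,
          (forall f e f' e' C, f <= f' -> e' <= e -> P (f, e, C) -> P (f', e', C)) ->
          all P s -> all P (tk ++ rs)].
Proof.
elim: s a => [|[[f e] C] s IH] a /=; first by exists [::], [::].
move=> /andP[fe ne]; set a' := fill_step _ _ _ _ _.
have [tk [rs [H1 H2 [H3 H3'] H4 [H5 H6]]]] := IH a' ne.
have [av|nav] := boolP ((0 < a.1) && available m D j (f, e, C)); last first.
  have Ea : a' = (a.1, (f, e, C) :: a.2) by rewrite /a' /fill_step ifN.
  exists tk, ((f, e, C) :: rs); split.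
  - apply: perm_trans H1 _; rewrite Ea.
    by apply/permP => P; rewrite !(count_cat, count_map) /= ?count_cat; lia.
  - by move=> t P; rewrite !nseg_cons H2 addnCA.
  - by split=> //; move: H3; rewrite !all_cat /= => /andP[-> ->]; rewrite fe.
  - by apply: (etrans H4); rewrite Ea.
  - split=> [r0|P Pm /= /andP[PC Ps]].
      rewrite /= H5 // andbT; apply: contra nav => ->; rewrite andbT.
      have E : a.1 = a'.1 by rewrite Ea.
      by rewrite E -H4 ltn_addl.
    by have := H6 P Pm Ps; rewrite !all_cat /= PC.
have /andP[a0 av'] := av.
have [er|re] := leqP (e - f) a.1.
  have Ea : a' = (a.1 - (e - f), (f, e, j :: C) :: a.2) by rewrite /a' /fill_step ifT //= er.
  exists ((f, e, C) :: tk), rs; split.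
  - apply: perm_trans H1 _; rewrite Ea.
    by apply/permP => P; rewrite /= !(count_cat, count_map) /=; lia.
  - by move=> t P; rewrite !nseg_cons H2 addnA.
  - by rewrite /= fe av'.
  - by move: H4; rewrite Ea /measure /=; lia.
  - split=> // P Pm /= /andP[PC Ps]; rewrite PC; exact: H6 Pm Ps.
have Ea : a' = (0, (f, f + a.1, j :: C) :: (f + a.1, e, C) :: a.2).
  by rewrite /a' /fill_step ifT //= leqNgt re.
(* Nothing remains to be placed and segments are nonempty, so none is taken after this one. *)
have tk0 : tk = [::].
  move: H4 H3; rewrite Ea; case: (tk) => // g u /=; rewrite /measure /= => H /andP[gg _]; lia.
exists [:: (f, f + a.1, C)], ((f + a.1, e, C) :: rs); split.
- apply: perm_trans H1 _; rewrite Ea tk0.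
  by apply/permP => P; rewrite /= !count_cat /=; lia.
- move=> t P; move: (H2 t P); rewrite tk0 !nseg_cons => ->.
  by rewrite /nseg /cov /=; case: (P C); rewrite ?andbT ?andbF; lia.
- split; first by rewrite /= ; move: H3; rewrite tk0 /= => ->; rewrite andbT; lia.
  by move: av'; rewrite /available /= => /and3P[-> ? ->]; rewrite !andbT; lia.
- by move: H4; rewrite tk0 Ea /measure /=; lia.
- split=> [r0|P Pm /= /andP[PC Ps]]; first by move: H4 r0; rewrite Ea /=; lia.
  have := H6 P Pm Ps; rewrite tk0 /= => ->.
  rewrite andbT (Pm f e f _ C _ _ PC) //=; last by lia.
  by apply: (Pm f e _ e C _ _ PC); rewrite ?leq_addr.
Qed.

Lemma perm_pref_first D s : perm_eq (pref_first D s) s.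
Proof. by rewrite /pref_first; apply/permPl; exact: perm_filterC. Qed.

Lemma sum_interval f e T : \sum_(0 <= t < T) (f <= t < e) = minn e T - f.
Proof.
elim: T => [|T IH]; first by rewrite big_geq // minn0.
by rewrite big_nat_recr //= IH; lia.
Qed.

Lemma sum_nseg T s : (forall t, T <= t -> nseg s t predT = 0) ->
  all (fun g => g.1.1 < g.1.2) s -> measure s = \sum_(0 <= t < T) nseg s t predT.
Proof.
elim: s => [|[[f e] C] s IH] H /=; first by rewrite big1.
move=> /andP[/= fe ne]; rewrite /measure /= -/(measure s) IH //; last first.
  by move=> t /H; rewrite /nseg /=; lia.
have eT : e <= T.
  rewrite leqNgt; apply/negP => Te; have := H e.-1; rewrite /nseg /= /cov /= ?andbT.
  by rewrite (_ : f <= e.-1 < e); lia.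
rewrite [RHS](eq_bigr (fun t => (f <= t < e) + nseg s t predT)); last first.
  by move=> t _; rewrite /cov /= andbT.
by rewrite big_split /= sum_interval (minn_idPl eT).
Qed.

Lemma nseg_le s t P : nseg s t P <= nseg s t predT.
Proof. by apply: sub_count => g /andP[->]. Qed.

Lemma nseg_mem s t g : g \in s -> cov t g -> 0 < nseg s t (pred1 g.2).
Proof. by move=> gs gt; rewrite -has_count; apply/hasP; exists g; rewrite //= gt eqxx. Qed.

Lemma nseg_map_cons j s t P :
  nseg [seq (g.1, j :: g.2) | g <- s] t P = nseg s t (fun C => P (j :: C)).
Proof. by rewrite /nseg count_map. Qed.

Lemma sum_window F a b T : b <= T -> (forall t, ~~ (a <= t < b) -> F t = 0) ->
  \sum_(0 <= t < T) F t = \sum_(a <= t < b) F t.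
Proof.
move=> bT F0; have [ab|ba] := leqP a b; last first.
  rewrite [RHS]big_geq 1?ltnW // big1 // => t _; apply: F0; lia.
rewrite (big_cat_nat (n := a)) //=; last by lia.
rewrite (big_cat_nat (n := b) (m := a)) //=.
rewrite big_nat_cond big1 => [|t]; last by rewrite andbT => ?; apply: F0; lia.
rewrite [X in _ + (_ + X)]big_nat_cond [X in _ + (_ + X)]big1 ?addn0 // => t.
by rewrite andbT => ?; apply: F0; lia.
Qed.

(** [X] is the set of slots given to [j]. The duration is missed only when every slot of the block
    that accepts [j] is used. The last clause is the effect of [pref_first]: other slots are used
    only once all preferred ones have been tried. *)
Lemma place_spec m D T s j : wf T s -> lo j + len j <= T ->
  exists X : pred nat,
   [/\ wf T (place m D s j),
       forall t, cont (place m D s j) t = if X t then j :: cont s t else cont s t,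
       forall t, X t -> (lo j <= t < lo j + len j) && fits m D (j :: cont s t),
       \sum_(lo j <= t < lo j + len j) X t <= dur j /\
       (\sum_(lo j <= t < lo j + len j) X t < dur j ->
        forall t, lo j <= t < lo j + len j -> fits m D (j :: cont s t) -> X t) &
       forall t t', X t -> ~~ preferred D (cont s t) -> lo j <= t' < lo j + len j ->
         preferred D (cont s t') -> fits m D (j :: cont s t') -> X t'].
Proof.
move=> ws jT; rewrite /place; set s1 := cut (lo j + len j) (cut (lo j) s).
have ws1 : wf T s1 by do 2!apply: wf_cut.
(* After the cuts, a segment that meets the block lies inside it, so that [available] reduces to
   [fits]. *)
have in1 g t : cov t g -> ~~ straddles (lo j) g && ~~ straddles (lo j + len j) g ->
    lo j <= t < lo j + len j -> (lo j <= g.1.1) && (g.1.2 <= lo j + len j).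
  by rewrite /cov /straddles; lia.
have st1 : all (fun g => ~~ straddles (lo j) g && ~~ straddles (lo j + len j) g) s1.
  rewrite all_predI; apply/andP; split; last by apply: cut_straddle (wf_cut _ ws).
  by apply: all_cut_straddle; apply: cut_straddle ws.
have ne1 := ws1.1; have p1 := perm_pref_first D s1.
rewrite /pref_first foldl_cat in p1 *.
set sp := [seq g <- s1 | preferred D g.2] in p1 *.
set sn := [seq g <- s1 | ~~ preferred D g.2] in p1 *.
have fp : all (fun g => preferred D g.2) sp := filter_all _ _.
have fn : all (fun g => ~~ preferred D g.2) sn := filter_all _ _.
have ns1 t P : nseg s1 t P = nseg s t P by rewrite !nseg_cut.
have := st1; have := ne1; rewrite -!(perm_all _ p1) !all_cat => /andP[nep nen] /andP[stp stn].
have [tk1 [rs1 [A1 A2 [A3 A3'] A4 [A5 A6]]]] := fill_spec m D j (dur j, [::]) nep.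
have [tk2 [rs2 [B1 B2 [B3 B3'] B4 [B5 B6]]]] :=
  fill_spec m D j (foldl (fill_step m D j) (dur j, [::]) sp) nen.
move: A1 A4 A5 B1 B4 B5; set r1 := foldl _ (dur j, _) _; set r2 := foldl _ r1 _.
rewrite /= => A1 A4 A5 B1 B4 B5; clearbody r1 r2 s1 sp sn; set s' := r2.2.
pose tk := tk1 ++ tk2; pose rs := rs1 ++ rs2; pose X t := has (cov t) tk.
have ns t P : nseg s t P = nseg tk t P + nseg rs t P.
  rewrite -ns1 -(nseg_perm _ _ p1).
  by rewrite nseg_cat A2 B2 /tk /rs (nseg_cat tk1) (nseg_cat rs1) addnACA.
have ns' t P : nseg s' t P = nseg tk t (fun C => P (j :: C)) + nseg rs t P.
  rewrite (nseg_perm _ _ B1) nseg_cat (nseg_cat rs2) (nseg_perm _ _ A1) nseg_cat cats0.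
  rewrite !nseg_map_cons /tk /rs (nseg_cat tk1) (nseg_cat rs1).
  by move: (nseg tk1 t _) (nseg tk2 t _) (nseg rs1 t P) (nseg rs2 t P) => a b c d; clear; lia.
have XE t : X t = (0 < nseg tk t predT) by rewrite nseg_predT -has_count.
have tkT t : X t -> t < T /\ forall P, nseg rs t P = 0.
  rewrite XE => Xt; have := ns t predT; rewrite (nseg_cont _ _ ws) andbT => E.
  have [tT r0] : t < T /\ nseg rs t predT = 0 by clear -E Xt; move: E Xt; case: (t < T); lia.
  by split=> // P; apply/eqP; rewrite -leqn0 -r0 nseg_le.
have tk0 t P : ~~ X t -> nseg tk t P = 0.
  by rewrite XE -leqNgt leqn0 => /eqP X0; apply/eqP; rewrite -leqn0 -X0 nseg_le.
have tkE t g : g \in tk -> cov t g -> X t /\ g.2 = cont s t.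
  move=> gk gt; have Xt : X t by apply/hasP; exists g.
  split=> //; have := nseg_mem gk gt; have [_ r0] := tkT t Xt.
  have := ns t (pred1 g.2); rewrite r0 addn0 (nseg_cont _ _ ws) /= => <-.
  by case: eqP => // _; rewrite andbF.
have rsE t g : g \in rs -> cov t g -> g.2 = cont s t.
  move=> gr gt; have := nseg_mem gr gt; case: (boolP (X t)) => [/tkT[_ ->] //|Xt].
  have := ns t (pred1 g.2); rewrite (tk0 _ _ Xt) add0n (nseg_cont _ _ ws) /= => <-.
  by case: eqP => // _; rewrite andbF.
have av_tk : all (available m D j) tk by rewrite all_cat A3' B3'.
have ne_tk : all (fun g => g.1.1 < g.1.2) tk.
  by move: A3 B3; rewrite !all_cat => /andP[-> _] /andP[-> _].
have ne_rs : all (fun g => g.1.1 < g.1.2) rs.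
  by move: A3 B3; rewrite !all_cat => /andP[_ ->] /andP[_ ->].
have strs : all (fun g => ~~ straddles (lo j) g && ~~ straddles (lo j + len j) g) rs.
  have Pm : forall f e f' e' (C : seq item), f <= f' -> e' <= e ->
     ~~ straddles (lo j) (f, e, C) && ~~ straddles (lo j + len j) (f, e, C) ->
     ~~ straddles (lo j) (f', e', C) && ~~ straddles (lo j + len j) (f', e', C).
    by clear; move=> f e f' e' C; rewrite /straddles /=; lia.
  by have := A6 _ Pm stp; have := B6 _ Pm stn; rewrite !all_cat => /andP[_ ->] /andP[_ ->].
have Xwin t : X t -> (lo j <= t < lo j + len j) && fits m D (j :: cont s t).
  move=> /hasP[g gk gt]; have [_ <-] := tkE _ _ gk gt.
  move: (allP av_tk _ gk) gt; rewrite /available /cov => /and3P[lg gh ->]; clear -lg gh; lia.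
have wf' : wf T s'.
  split=> [|t]; last by rewrite ns' -ns (nseg_cont _ _ ws) andbT.
  rewrite (perm_all _ B1) !all_cat (perm_all _ A1) !all_cat !all_map /=.
  by move: ne_tk ne_rs; rewrite !all_cat => /andP[-> ->] /andP[-> ->].
have rs_ex t : lo j <= t < lo j + len j -> fits m D (j :: cont s t) -> ~~ X t ->
    exists g, [/\ g \in rs, available m D j g & g.2 = cont s t].
  move=> tw tf Xt; have := ns t predT; rewrite (tk0 _ _ Xt) (nseg_cont _ _ ws) andbT.
  have -> : t < T by clear -tw jT; lia.
  rewrite nseg_predT => E; have : has (cov t) rs by rewrite has_count -[count _ _]add0n -E.
  move=> /hasP[g gr gt]; exists g; have E2 := rsE _ _ gr gt; split=> //.
  by rewrite /available E2 tf andbT; apply: in1 gt _ tw; apply: (allP strs).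
exists X; split=> //.
- move=> t; case: (boolP (X t)) => Xt.
    have [tT r0] := tkT t Xt; apply: (cont_eq wf') => // P.
    rewrite ns' r0 addn0; have := ns t (fun C => P (j :: C)).
    by rewrite r0 addn0 => <-; rewrite (nseg_cont _ _ ws) tT.
  have [tT|Tt] := ltnP t T; last by rewrite (cont_out ws) ?(cont_out wf').
  apply: (cont_eq wf') => // P; rewrite ns' (tk0 _ _ Xt).
  by have := ns t P; rewrite (tk0 _ _ Xt) (nseg_cont _ _ ws) tT /= => <-.
- have -> : \sum_(lo j <= t < lo j + len j) X t = measure tk.
    rewrite (sum_nseg (T := T)) //; last first.
      by move=> t Tt; apply: tk0; apply/negP => /tkT[]; rewrite ltnNge Tt.
    rewrite -(sum_window (F := X) (T := T)) //; last first.
      by move=> t tw; apply/eqP; rewrite eqb0; apply: contra tw => /Xwin /andP[].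
    apply: eq_bigr => t _; have := ns t predT; rewrite (nseg_cont _ _ ws) andbT XE.
    by case: (nseg tk t predT) => [|[|n]] //=; case: (t < T).
  have -> : measure tk = measure tk1 + measure tk2 by rewrite /measure map_cat sumn_cat.
  move: A4 B4; rewrite /= => A4 B4; split=> [|lt]; first by clear -A4 B4; lia.
  move=> t tw tf; apply/negPn/negP => Xt; have [g [gr ga _]] := rs_ex t tw tf Xt.
  have r20 : 0 < r2.1 by clear -A4 B4 lt; lia.
  have r10 : 0 < r1.1 by clear -r20 B4; lia.
  by move: gr; rewrite mem_cat => /orP[/(allP (A5 r10))|/(allP (B5 r20))]; rewrite /= ga.
- move=> t t' /hasP[g gk gt]; have [_ <-] := tkE _ _ gk gt => gnp tw tp tf.
  apply/negPn/negP => Xt; have [g' [gr ga gE]] := rs_ex t' tw tf Xt.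
  have Pm (p : pred (seq item)) : forall f e f' e' (C : seq item), f <= f' -> e' <= e ->
    p (f, e, C).2 -> p (f', e', C).2 by [].
  have := A6 (fun g => preferred D g.2) (Pm _) fp; rewrite all_cat => /andP[pt1 pr1].
  have := B6 (fun g => ~~ preferred D g.2) (Pm (fun C => ~~ preferred D C)) fn.
  rewrite all_cat => /andP[pt2 pr2].
  (* The segment [g] was taken in the second pass; hence some duration was left after the first one,
     which therefore skipped no available segment. *)
  have g2 : g \in tk2.
    by move: gk; rewrite mem_cat => /orP[/(allP pt1)|//]; rewrite /= (negbTE gnp).
  have r10 : 0 < r1.1.
    rewrite -B4 ltn_addr //; move: ne_tk; rewrite all_cat => /andP[_ /allP/(_ _ g2)].
    move: g2 => /splitPr [u v] gg; rewrite /measure map_cat sumn_cat /=; clear -gg; lia.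
  move: gr; rewrite mem_cat => /orP[/(allP (A5 r10))|/(allP pr2)]; first by rewrite /= ga.
  by rewrite /= gE tp.
Qed.

(** * Scheduling by increasing block length *)

Definition dyadic (x : item) := exists k a, len x = 2 ^ k /\ lo x = a * 2 ^ k.

Definition compat (i x : item) : bool :=
  [|| inside i x, lo x + len x <= lo i | lo i + len i <= lo x].

(** The ends of the longer block are multiples of the length of the shorter one. *)
Lemma dyadic_compat i x : dyadic i -> dyadic x -> len x <= len i -> compat i x.
Proof.
move=> [k [a [li ai]]] [l [b [lx bx]]]; rewrite /compat /inside li lx ai bx leq_exp2l //.
move=> lk; rewrite -(subnK lk) expnD; move: (2 ^ (k - l)) (2 ^ l) => c d.
have [h1|h1] := ltnP b (a * c).
  by have := leq_mul h1 (leqnn d); clear; lia.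
have [h2|h2] := leqP (a * c + c) b.
  by have := leq_mul h2 (leqnn d); clear; lia.
have := leq_mul h1 (leqnn d); have := leq_mul h2 (leqnn d).
by clear; lia.
Qed.

(** An aligned block is the union of its two halves, so a bound on the average passes to longer
    blocks. *)
Lemma dyadic_lift (F : nat -> nat) L P k l : k <= l ->
  (forall a, (\sum_(a * 2 ^ k <= t < a * 2 ^ k + 2 ^ k) F t) * L <= P * 2 ^ k) ->
  forall a, (\sum_(a * 2 ^ l <= t < a * 2 ^ l + 2 ^ l) F t) * L <= P * 2 ^ l.
Proof.
move=> kl H; elim: l kl => [|l IH]; first by rewrite leqn0 => /eqP k0; move: H; rewrite k0.
rewrite leq_eqVlt => /orP[/eqP <- //|]; rewrite ltnS => /IH {}IH a.
have := IH (2 * a); have := IH (2 * a + 1).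
have -> : (2 * a + 1) * 2 ^ l = 2 * a * 2 ^ l + 2 ^ l by rewrite mulnDl mul1n.
have -> : a * 2 ^ l.+1 = 2 * a * 2 ^ l by rewrite expnS; lia.
have -> : 2 ^ l.+1 = 2 ^ l + 2 ^ l by rewrite expnS mul2n addnn.
move: (2 ^ l) => p; move: (2 * a * p) => u H1 H2.
rewrite addnA (big_cat_nat (n := u + p)) ?leq_addr //=.
by rewrite mulnDl mulnDr leq_add.
Qed.

Lemma bvol_cons j B i : bvol (j :: B) i = (if inside i j then vol j else 0) + bvol B i.
Proof. by rewrite /bvol /=; case: ifP. Qed.

Section Sched.
Variables m D T P L : nat.
Hypotheses (m_gt0 : 0 < m) (D_gt0 : 0 < D) (L_gt0 : 0 < L).

Definition good (x : item) := [/\ sz_ok D x, vol x = dur x * halfw D (sz x) & dyadic x].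

(** [P / L] plays the role of lam in integer arithmetic. The bad slots are only bounded in blocks at
    least as long as those placed so far: a long job may create its bad slots within a short
    block. *)
Definition sched_inv (done : seq item) (s : seq segment) : Prop :=
  [/\ wf T s,
      forall t x, x \in cont s t -> x \in done /\ lo x <= t < lo x + len x,
      forall t, uniq (cont s t) /\ fits m D (cont s t),
      forall x, x \in done -> dur x <= \sum_(lo x <= t < lo x + len x) (x \in cont s t) &
      (forall i, (forall x, x \in done -> compat i x) ->
        \sum_(lo i <= t < lo i + len i) weight D (cont s t) <= bvol done i) /\
      forall k, (forall x, x \in done -> len x <= 2 ^ k) -> forall a,
        (\sum_(a * 2 ^ k <= t < a * 2 ^ k + 2 ^ k) bad m D (cont s t)) * L <= P * 2 ^ k].

Lemma place_full j (c : nat -> seq item) (X : pred nat) :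
  sz_ok D j -> (forall t, all (sz_ok D) (c t)) ->
  (forall t, lo j <= t < lo j + len j -> fits m D (j :: c t) -> X t) ->
  (\sum_(lo j <= t < lo j + len j) bad m D (c t)) * L <= P * len j ->
  (\sum_(lo j <= t < lo j + len j) weight D (c t)) * L + D * m.+1 * P * len j
     <= D * m * L * len j ->
  dur j * L <= P * len j ->
  dur j <= \sum_(lo j <= t < lo j + len j) X t.
Proof.
move=> jok cok full.
set B := \sum_(_ <= t < _) bad _ _ _; set W := \sum_(_ <= t < _) weight _ _.
set N := \sum_(_ <= t < _) X _ => HB HW Hd; rewrite leqNgt; apply/negP => Nd.
pose U := \sum_(lo j <= t < lo j + len j) ~~ fits m D (j :: c t).
have HU : m * D * U <= W + B * D.
  rewrite /U /W /B big_distrr big_distrl -big_split; apply: leq_sum => t _ /=.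
  case: (boolP (fits m D (j :: c t))) => nf; first by rewrite muln0.
  by rewrite muln1; apply: unfit_weight nf.
have HN : len j <= U + N.
  rewrite /U /N -big_split /=.
  apply: (@leq_trans (\sum_(lo j <= t < lo j + len j) 1)).
    by rewrite sum_nat_const_nat muln1 addKn leqnn.
  rewrite big_nat_cond [leqRHS]big_nat_cond; apply: leq_sum => t; rewrite andbT => tw.
  by case: (boolP (fits _ _ _)) => //= /(full _ tw) ->.
have h1 : m * D * L * len j + m * D * L <= m * D * L * U + m * D * L * dur j.
  by rewrite -!mulnDr -mulnSr leq_mul2l; apply/orP; right; clear -HN Nd; lia.
have h2 : m * D * L * U <= W * L + B * D * L.
  by rewrite -mulnA [L * U]mulnC mulnA -mulnDl leq_mul2r HU orbT.
have h3 : B * D * L <= D * P * len j.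
  by rewrite [B * D]mulnC -!mulnA leq_mul2l HB orbT.
have h4 : m * D * L * dur j <= m * D * P * len j.
  by rewrite -!mulnA !leq_mul2l [L * _]mulnC Hd !orbT.
have h5 : 0 < m * D * L by rewrite !muln_gt0 m_gt0 D_gt0.
(* The first share pays for the bad slots, the second one for the slots that accept [j], of which
   there are fewer than [dur j]. *)
have e1 : D * m.+1 * P * len j = D * P * len j + m * D * P * len j.
  by rewrite mulnS !mulnDl [D * m]mulnC.
have e2 : D * m * L * len j = m * D * L * len j by rewrite [D * m]mulnC.
rewrite e1 e2 in HW.
clear -h1 h2 h3 h4 h5 HW; move: (m * D * L * len j) (D * P * len j) (m * D * P * len j)
 (W * L) (B * D * L) (m * D * L * U) (m * D * L * dur j) (m * D * L) h1 h2 h3 h4 h5 HW.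
lia.
Qed.

(** The blocks in [done] are not longer than that of [j], hence inside it or disjoint from it, so
    the weight clause applies to the block of [j] and [place_full] shows that the whole duration is
    found. *)
Lemma place_inv done s j : sched_inv done s -> j \notin done -> good j ->
  (forall x, x \in done -> good x /\ len x <= len j) -> lo j + len j <= T ->
  dur j * L <= P * len j ->
  bvol done j * L + D * m.+1 * P * len j <= D * m * L * len j ->
  sched_inv (j :: done) (place m D s j).
Proof.
move=> [ws mem_c uf dur_c [vol_c bad_c]] jd [jok jv jdy] gd jT Hd Hv.
have [X [ws' c' Xwin [XN Xfull] Xpref]] := place_spec m D ws jT.
have cok t : all (sz_ok D) (cont s t).
  by apply/allP => x /mem_c [/gd [[]]].
have [k [a0 [lk la]]] := jdy.
have bad_k : forall a, (\sum_(a * 2 ^ k <= t < a * 2 ^ k + 2 ^ k) bad m D (cont s t)) * L <= P * 2 ^ k.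
  by apply: bad_c => x /gd [_]; rewrite -lk.
have XE : \sum_(lo j <= t < lo j + len j) X t = dur j.
  apply/eqP; rewrite eqn_leq XN /=; rewrite leqNgt; apply/negP => lt.
  have := Xfull lt => full; move: lt; rewrite ltnNge => /negP; apply.
  apply: (place_full jok cok full) => //; first by rewrite lk la.
  apply: leq_trans Hv; rewrite leq_add2r leq_mul2r; apply/orP; right; apply: vol_c.
  by move=> x /gd [[_ _ xdy]]; apply: dyadic_compat.
have jc t : j \notin cont s t by apply: contra jd => /mem_c [].
have Xin t : X t -> lo j <= t < lo j + len j by move=> /Xwin /andP[].
split=> //.
- move=> t x; rewrite c' inE; case: ifP => Xt.
    rewrite inE => /orP[/eqP ->|/mem_c [-> ->]]; last by rewrite orbT.
    by rewrite eqxx (Xin _ Xt).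
  by move=> /mem_c [-> ->]; rewrite orbT.
- move=> t; rewrite c'; case: ifP => // Xt; split; last by have /andP[] := Xwin _ Xt.
  by rewrite /= jc (uf t).1.
- move=> x; rewrite inE => /orP[/eqP ->|xd].
    rewrite -XE; apply: leq_sum => t _; rewrite c'; case: (X t) => //.
    by rewrite inE eqxx.
  apply: leq_trans (dur_c _ xd) _; apply: leq_sum => t _; rewrite c'; case: (X t) => //.
  by rewrite inE; case: (x \in cont s t) => //; rewrite orbT.
split.
- move=> i Hi.
  have -> : \sum_(lo i <= t < lo i + len i) weight D (cont (place m D s j) t) =
      halfw D (sz j) * (\sum_(lo i <= t < lo i + len i) X t) +
      \sum_(lo i <= t < lo i + len i) weight D (cont s t).
    rewrite big_distrr -big_split; apply: eq_bigr => t _ /=; rewrite c'.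
    by case: (X t); rewrite ?muln0 ?muln1.
  rewrite bvol_cons; apply: leq_add; last first.
    by apply: vol_c => x xd; apply: Hi; rewrite inE xd orbT.
  case: ifP => ij.
    rewrite jv mulnC leq_mul2r; apply/orP; right; rewrite -XE.
    move: ij; rewrite /inside => /andP[i1 i2].
    rewrite -(sum_window (F := X) (a := lo i) (leqnn _)) ?(sum_window (F := X) (a := lo j) i2) // => t tw.
      by apply/eqP; rewrite eqb0; apply: contra tw => /Xin.
    by apply/eqP; rewrite eqb0; apply: contra tw => /Xin; clear -i1 i2; lia.
  rewrite big_nat_cond big1 ?muln0 // => t; rewrite andbT => tw; apply/eqP; rewrite eqb0.
  apply/negP => /Xin; have := Hi j; rewrite inE eqxx /compat ij /= => /(_ isT).
  clear -tw; lia.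
- move=> l Hl; have kl : k <= l by have := Hl j; rewrite inE eqxx lk leq_exp2l // => ->.
  (* Blocks as long as that of [j] suffice, and among them only its own is affected. *)
  apply: (dyadic_lift kl) => a; have [->|aa0] := eqVneq a a0; last first.
    apply: leq_trans (bad_k a); rewrite leq_mul2r; apply/orP; right.
    rewrite big_nat_cond [leqRHS]big_nat_cond; apply: leq_sum => t; rewrite andbT => tw.
    rewrite c' ifN //; apply/negP => /Xin; rewrite lk la; move: tw aa0; clear.
    move: (2 ^ k) => d; rewrite neq_ltn => ta /orP[] lt tb.
      by have := leq_mul lt (leqnn d); rewrite mulSn; lia.
    by have := leq_mul lt (leqnn d); rewrite mulSn; lia.
  have [jn|jw] := boolP (narrow D j); last first.
    apply: leq_trans (bad_k a0); rewrite leq_mul2r; apply/orP; right; apply: leq_sum => t _.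
    rewrite c'; case: (X t) => //.
    by have := @bad_cons_wide m D j (cont s t) jw; do 2!case: (bad _ _ _) => //; move=> /(_ isT).
  have [/hasP[t' tw /andP[bt' Xt']]|nob] :=
    boolP (has (fun t => bad m D (cont s t) && ~~ X t) (index_iota (lo j) (lo j + len j))).
    apply: leq_trans (bad_k a0); rewrite leq_mul2r; apply/orP; right; apply: leq_sum => t _.
    rewrite c'; case: (boolP (X t)) => // Xt.
    case: (boolP (bad m D (j :: cont s t))) => // bt.
    rewrite (bad_cons_narrow jn bt) //; apply/negPn/negP => np.
    move/negP: Xt'; apply; apply: (Xpref _ _ Xt np).
    - by move: tw; rewrite mem_index_iota.
    - by case/andP: bt'.
    - exact: bad_fits.
  rewrite -la -lk; apply: leq_trans Hd; rewrite leq_mul2r; apply/orP; right; rewrite -XE.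
  rewrite big_nat_cond [leqRHS]big_nat_cond; apply: leq_sum => t; rewrite andbT => tw.
  rewrite c'; case: (boolP (X t)) => Xt; first by rewrite leq_b1.
  have := hasPn nob t; rewrite mem_index_iota => /(_ tw).
  by rewrite Xt andbT => /negbTE ->.
Qed.

Lemma init_inv : 0 < T -> sched_inv [::] [:: (0, T, [::])].
Proof.
move=> T0; have c0 t : cont [:: (0, T, [::])] t = [::] by rewrite /cont /=; case: ifP.
split=> //.
- split=> [|t]; first by rewrite /= T0.
  by rewrite /nseg /= /cov /= andbT addn0.
- by move=> t x; rewrite c0.
- by move=> t; rewrite c0.
split=> [i _|k _ a]; first by rewrite big1 // => t _; rewrite c0.
by rewrite big1 // => t _; rewrite c0.
Qed.

Lemma bvol_cat A B i : bvol (A ++ B) i = bvol A i + bvol B i.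
Proof. by rewrite /bvol filter_cat map_cat sumn_cat. Qed.

Lemma bvol_perm A B i : perm_eq A B -> bvol A i = bvol B i.
Proof. by move=> AB; rewrite /bvol; apply/perm_sumn/perm_map/perm_filter. Qed.

Lemma sched_ok A : 0 < T -> uniq A -> sorted (fun x y => len x <= len y) A ->
  (forall x, x \in A -> [/\ good x, lo x + len x <= T, dur x * L <= P * len x &
     bvol A x * L + D * m.+1 * P * len x <= D * m * L * len x]) ->
  exists done, perm_eq done A /\ sched_inv done (foldl (place m D) [:: (0, T, [::])] A).
Proof.
move=> T0 uA sA HA.
suff H rest done s : perm_eq (done ++ rest) A -> sorted (fun x y => len x <= len y) rest ->
    (forall x y, x \in done -> y \in rest -> len x <= len y) -> sched_inv done s ->
    exists done', perm_eq done' A /\ sched_inv done' (foldl (place m D) s rest).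
  by apply: H (init_inv T0).
elim: rest done s => [|j rest IH] done s pA srt le_len inv /=.
  by exists done; rewrite cats0 in pA.
have jA : j \in A by rewrite -(perm_mem pA) mem_cat inE eqxx orbT.
have [gj jT Hd Hv] := HA _ jA.
apply: (IH (j :: done)).
- by apply: perm_trans pA; apply/permP => p; rewrite !count_cat /= addnCA addnA.
- exact: path_sorted srt.
- move=> x y; rewrite inE => /orP[/eqP ->|xd] yr; last by apply: le_len => //; rewrite inE yr orbT.
  move: srt => /=; rewrite path_sortedE; last by move=> ? ? ?; apply: leq_trans.
  by move=> /andP[/allP/(_ y yr)].
- apply: place_inv => //.
  + have : uniq (done ++ j :: rest) by rewrite (perm_uniq pA).
    by rewrite cat_uniq => /and3P[_ /hasPn/(_ j)]; rewrite inE eqxx => /(_ isT).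
  + move=> x xd; split; last by apply: le_len; rewrite // inE eqxx.
    by have [] := HA x; first by rewrite -(perm_mem pA) mem_cat xd.
  + apply: leq_trans Hv; rewrite leq_add2r leq_mul2r; apply/orP; right.
    by rewrite -(bvol_perm _ pA) bvol_cat leq_addr.
Qed.

End Sched.

(** * Sorting and dyadic blocks *)

Lemma perm_insert (A : eqType) (le : rel A) x s : perm_eq (insert le x s) (x :: s).
Proof.
rewrite /insert -cat1s perm_catCA /= perm_cons; apply/permPl; exact: perm_filterC.
Qed.

Lemma perm_isort (A : eqType) (le : rel A) s : perm_eq (isort le s) s.
Proof.
suff H u v : perm_eq (foldl (fun a x => insert le x a) u v) (u ++ v).
  by have := H [::] s.
elim: v u => [|x v IH] u /=; first by rewrite cats0.
apply: perm_trans (IH _) _; apply: (@perm_trans _ ((x :: u) ++ v)).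
  by rewrite perm_cat2r perm_insert.
by rewrite -[x :: v]cat1s perm_sym perm_catCA.
Qed.

(** Relative to [P], because a cross-multiplied comparison such as [denser] needs positive
    denominators to be transitive. *)
Lemma pairwise_isort (A : eqType) (P : pred A) (le : rel A) s :
  {in P &, total le} -> {in P & &, transitive le} -> all P s -> pairwise le (isort le s).
Proof.
move=> tot trans; rewrite /isort.
have : all P [::] && pairwise le [::] by [].
elim: s [::] => [|x s IH] u //= /andP[Pu su]; first by [].
move=> /andP[Px Ps]; apply: IH => //; rewrite (perm_all _ (perm_insert le x u)) /= Px Pu /=.
rewrite /insert pairwise_cat /= !pairwise_filter // andbT; apply/andP; split; last first.
  apply/allP => z; rewrite mem_filter => /andP[nzx zu].
  by have := tot x z Px (allP Pu _ zu); rewrite (negbTE nzx) orbF.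
apply/allrelP => y z; rewrite mem_filter inE => /andP[yx yu] /orP[/eqP -> //|].
rewrite mem_filter => /andP[nzx zu].
have := tot x z Px (allP Pu _ zu); rewrite (negbTE nzx) orbF.
exact: (trans x y z Px (allP Pu _ yu) (allP Pu _ zu)).
Qed.

(** [(r + P - 1) %/ P * P] is [r] rounded up to a multiple of [P]: the first possible start of an
    aligned block. *)
Lemma ceil_spec r P : 0 < P -> r <= (r + P - 1) %/ P * P < r + P /\
  forall c, r <= c * P -> (r + P - 1) %/ P * P <= c * P.
Proof.
move=> P0; have E := divn_eq (r + P - 1) P; have := ltn_pmod (r + P - 1) P0.
move: E; set q := _ %/ _; set u := _ %% _ => E uP; split; first by lia.
move=> c rc; rewrite leq_mul2r; apply/orP; right; rewrite -ltnS.
by rewrite -(ltn_pmul2r P0) mulSn; lia.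
Qed.

(** Rounding up to a multiple of half the power loses less than that half, so a block of half length
    always fits. The maximality in the last clause is what later confines the window to a
    neighbourhood of its block. *)
Lemma block_spec r d : r <= d -> let bl := block r d in
  [/\ exists k b, bl.2 = 2 ^ k /\ bl.1 = b * 2 ^ k,
      r <= bl.1, bl.1 + bl.2 <= d.+1, d.+1 - r <= 4 * bl.2 &
      forall l c, r <= c * 2 ^ l -> c * 2 ^ l + 2 ^ l <= d.+1 -> 2 ^ l <= bl.2].
Proof.
move=> rd; rewrite /block /pow2; set K := trunc_log 2 _.
have l0 : 0 < d.+1 - r by lia.
have K1 : 2 ^ K <= d.+1 - r := trunc_logP (isT : 1 < 2) l0.
have K2 : d.+1 - r < 2 ^ K.+1 := trunc_log_ltn (d.+1 - r) (isT : 1 < 2).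
have lK l c : r <= c * 2 ^ l -> c * 2 ^ l + 2 ^ l <= d.+1 -> l <= K.
  move=> h1 h2; rewrite -ltnS -(ltn_exp2l _ _ (isT : 1 < 2)); apply: leq_ltn_trans K2; lia.
have P0 : 0 < 2 ^ K by rewrite expn_gt0.
have [c1 c2] := ceil_spec r P0.
case: ifP => fit /=.
  split; [by exists K, ((r + 2 ^ K - 1) %/ 2 ^ K)| by lia | by [] | |].
    by move: K2; rewrite expnS; lia.
  by move=> l c h1 h2; rewrite leq_exp2l //; apply: lK h1 h2.
(* For [K = 0] rounding up changes nothing and the first test succeeds. *)
have K0 : 0 < K.
  rewrite lt0n; apply/eqP => K0; move: fit c1; rewrite K0 expn0 !muln1; lia.
have EQ : 2 ^ K %/ 2 = 2 ^ K.-1 by rewrite -{1}(prednK K0) expnS mulKn.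
have EK : 2 ^ K = 2 * 2 ^ K.-1 by rewrite -{1}(prednK K0) expnS.
rewrite EQ; have Q0 : 0 < 2 ^ K.-1 by rewrite expn_gt0.
have [e1 e2] := ceil_spec r Q0; split.
- by exists K.-1, ((r + 2 ^ K.-1 - 1) %/ 2 ^ K.-1).
- by case/andP: e1.
- by lia.
- by move: K2; rewrite expnS EK; lia.
move=> l c h1 h2; rewrite leq_exp2l // -ltnS (prednK K0) ltn_neqAle (lK _ _ h1 h2) andbT.
apply/eqP => lE; move: fit; rewrite lE in h1 h2.
by have := c2 c h1; lia.
Qed.

(** Left end of an interval of length [4 * len i]: the parent of [i] and the adjacent block of the
    same length as the parent, after it if [i] is the right half, before it if [i] is the left half.
    The subtraction truncates when [i] starts at 0. *)
Definition region (i : item) : nat :=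
  lo i - (if odd (lo i %/ len i) then len i else 2 * len i).

(* If the window contained the sibling of [i], or a block next to the parent of [i]
   and as long as it, then a block twice as long as [i] would fit in the window. *)
Lemma window_region i r d : dyadic i -> r <= d ->
  lo i <= (block r d).1 -> (block r d).1 + (block r d).2 <= lo i + len i ->
  region i <= r /\ d < region i + 4 * len i.
Proof.
move=> [k [b [li bi]]] rd; have [[l [a [E2 E1]]] ra ad _ mx] := block_spec rd.
move: ra ad mx; rewrite /region bi li E1 E2 mulnK ?expn_gt0 // => ra ad mx h1 h2.
have big c : r <= c * (2 * 2 ^ k) -> c * (2 * 2 ^ k) + 2 * 2 ^ k <= d.+1 -> False.
  rewrite -expnS => g1 g2; have := mx _ _ g1 g2; have := expn_gt0 2 k.
  by rewrite expnS /=; lia.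
have eqk c : r <= c * 2 ^ k -> c * 2 ^ k + 2 ^ k <= d.+1 ->
    a * 2 ^ l = b * 2 ^ k /\ 2 ^ l = 2 ^ k.
  by move=> g1 g2; have := mx _ _ g1 g2; lia.
have p0 : 0 < 2 ^ k by rewrite expn_gt0.
have l0 : 0 < 2 ^ l by rewrite expn_gt0.
have Eb := odd_double_half b; move: b./2 Eb => h; rewrite -muln2 => Eb.
move: (2 ^ k) (2 ^ l) (a * 2 ^ l) ra ad h1 h2 big eqk p0 l0 {mx E1 E2 li bi} => p q u.
case: (odd b) Eb => /= <-; rewrite ?add0n ?add1n => ra ad h1 h2 big eqk p0 q0; split.
- rewrite leqNgt; apply/negP => lt; have [||e e'] := eqk (h * 2); [by clear -lt ra ad h1 h2 p0 q0; lia..|].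
  by apply: (big h); clear -lt e e' ra ad h1 h2 p0 q0; lia.
- rewrite ltnNge; apply/negP => lt.
  by apply: (big h.+1); clear -lt ra ad h1 h2 p0 q0; lia.
- rewrite leqNgt; apply/negP => lt.
  case: h eqk big h1 h2 lt => [|h] eqk big h1 h2 lt; first by clear -lt; lia.
  by apply: (big h); clear -lt ra ad h1 h2 p0 q0; lia.
rewrite ltnNge; apply/negP => lt; have [||e e'] := eqk (h * 2).+1; [by clear -lt ra ad h1 h2 p0 q0; lia..|].
by apply: (big h); clear -lt e e' ra ad h1 h2 p0 q0; lia.
Qed.

(** * The greedy selection *)

Section Greedy.
Local Open Scope ring_scope.
Import Order.TTheory GRing.Theory Num.Theory.

Variables (R : realType) (m D : nat) (lam : R) (J : seq item) (O : pred item).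
Hypotheses (m_gt0 : (0 < m)%N) (D_gt0 : (0 < D)%N) (uJ : uniq J).
Hypothesis goodJ : forall x, x \in J -> [/\ dyadic x, (0 < len x)%N, (0 < vol x)%N,
  (vol x <= dur x * D)%N & (dur x)%:R <= lam * (len x)%:R].
Let kappa : R := m%:R - m.+2%:R * lam.
Hypotheses (kappa_ge0 : 0 <= kappa) (lam_ge0 : 0 <= lam).
Hypothesis volO : forall i, i \in J ->
  (\sum_(x <- J | O x && inside i x) vol x <= 8 * m * D * len i)%N.

Lemma bvolE B i : bvol B i = (\sum_(x <- B | inside i x) vol x)%N.
Proof. by rewrite /bvol sumnE big_map big_filter. Qed.

Lemma leq_sum_sub (s1 s2 : seq item) (F : item -> nat) (p q : pred item) : uniq s1 ->
  (forall x, x \in s1 -> p x -> (x \in s2) && q x) ->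
  (\sum_(x <- s1 | p x) F x <= \sum_(x <- s2 | q x) F x)%N.
Proof.
elim: s1 s2 q => [|x s1 IH] s2 q /=; first by rewrite big_nil.
move=> /andP[xs us] H; rewrite big_cons; case: ifP => px; last first.
  by apply: IH => // y ys; apply: H; rewrite inE ys orbT.
have /andP[x2 qx] := H x (mem_head _ _) px.
rewrite [leqRHS](big_rem x) //= qx leq_add2l; apply: leq_trans (IH (rem x s2) q us _) _ => // y ys py.
have /andP[y2 qy] := H y (mem_behead (s := x :: s1) ys) py; rewrite qy andbT.
have yx : y != x by apply: contraNneq xs => <-.
by move: y2; rewrite (perm_mem (perm_to_rem x2)) inE (negbTE yx).
Qed.

Definition tight (A : seq item) (i : item) : bool :=
  (i \in J) && (kappa * (D * len i)%:R <= (bvol A i)%:R).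

Lemma exists_max (T : eqType) d (U : orderType d) (f : T -> U) (s : seq T) : s != [::] ->
  exists2 x, x \in s & forall y, y \in s -> (f y <= f x)%O.
Proof.
elim: s => // x [|y s] IH _; first by exists x; rewrite ?mem_head // => y; rewrite inE => /eqP ->.
have [z zs Hz] := IH isT; have [xz|zx] := leP (f x) (f z).
  by exists z => [|t]; rewrite inE ?zs ?orbT // => /orP[/eqP ->|/Hz].
exists x => [|t]; rewrite inE ?eqxx // => /orP[/eqP -> //|/Hz tz].
exact: le_trans tz (ltW zx).
Qed.

(** A longest block of [Ts] is, by laminarity, disjoint from the blocks not inside it, so the
    volumes split and induction applies to the latter. On a single tight block, [volO] bounds one
    side and tightness the other. *)
Lemma cover_bound (A Ts : seq item) : {subset A <= J} -> all (tight A) Ts ->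
  kappa * (\sum_(x <- J | O x && has (inside^~ x) Ts) vol x)%:R <=
  (8 * m)%:R * (\sum_(x <- A | has (inside^~ x) Ts) vol x)%:R.
Proof.
move=> AJ; have [n] := ubnP (size Ts); elim: n Ts => // n IH Ts szT tT.
have [->|Tne] := eqVneq Ts [::].
  by rewrite !big1 ?mulr0 // => x; rewrite andbF.
have [i0 i0T max] := exists_max len Tne.
have /andP[i0J ti0] := allP tT _ i0T.
pose Us := [seq i <- Ts | ~~ inside i0 i].
have tU : all (tight A) Us by apply/allP => i; rewrite mem_filter => /andP[_ /(allP tT)].
have szU : (size Us < n)%N.
  rewrite -ltnS; apply: leq_trans szT; rewrite ltnS size_filter -(count_predC (inside i0) Ts).
  by rewrite -addn1 addnC leq_add2r -has_count; apply/hasP; exists i0; rewrite // /inside !leqnn.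
have split_cov x : x \in J -> has (inside^~ x) Ts = inside i0 x || has (inside^~ x) Us.
  move=> xJ; apply/idP/orP => [/hasP[i iT ix]|[ix|/hasP[i]]].
  - case: (boolP (inside i0 i)) => [i0i|ni]; last first.
      by right; apply/hasP; exists i; rewrite // mem_filter ni.
    by left; move: i0i ix; rewrite /inside; clear; lia.
  - by apply/hasP; exists i0.
  - by rewrite mem_filter => /andP[_ iT] ix; apply/hasP; exists i.
have disj x : x \in J -> inside i0 x -> has (inside^~ x) Us = false.
  move=> xJ i0x; apply/negbTE/hasPn => i; rewrite mem_filter => /andP[ni iT].
  have /andP[iJ _] := allP tT _ iT.
  have [di0 _ _ _ _] := goodJ i0J; have [di _ _ _ _] := goodJ iJ; have [_ lx _ _ _] := goodJ xJ.
  have := dyadic_compat di0 di (max _ iT); rewrite /compat (negbTE ni) /=.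
  by move: lx i0x; clear; rewrite /inside; lia.
have -> : (\sum_(x <- J | O x && has (inside^~ x) Ts) vol x =
    \sum_(x <- J | O x && inside i0 x) vol x + \sum_(x <- J | O x && has (inside^~ x) Us) vol x)%N.
  rewrite [LHS]big_mkcond [X in _ = (X + _)%N]big_mkcond [X in _ = (_ + X)%N]big_mkcond -big_split.
  apply: eq_big_seq => x xJ /=; rewrite split_cov //; case: (O x) => //=.
  by case: (boolP (inside i0 x)) => //= ix; rewrite disj // addn0.
have -> : (\sum_(x <- A | has (inside^~ x) Ts) vol x =
    \sum_(x <- A | inside i0 x) vol x +
    \sum_(x <- A | has (inside^~ x) Us) vol x)%N.
  rewrite [LHS]big_mkcond [X in _ = (X + _)%N]big_mkcond [X in _ = (_ + X)%N]big_mkcond -big_split.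
  apply: eq_big_seq => x /AJ xJ /=; rewrite split_cov //.
  by case: (boolP (inside i0 x)) => //= ix; rewrite disj // addn0.
set c := (8 * m)%:R; rewrite !natrD !mulrDr; apply: lerD; last exact: IH.
rewrite -bvolE; apply: le_trans (_ : kappa * (8 * m * D * len i0)%:R <= _).
  by rewrite ler_wpM2l // ler_nat volO.
by rewrite -mulnA natrM mulrCA -/c ler_wpM2l // ler0n.
Qed.

Let step (A : seq item) j := if admissible m D J (j :: A) then j :: A else A.

Lemma bvol_nil i : bvol [::] i = 0%N. Proof. by []. Qed.

Lemma admissible_nil : admissible m D J [::].
Proof.
apply/allP => i iJ; apply/allP => k kJ; rewrite bvol_nil mul0n add0n.
rewrite leq_mul2r; apply/orP; right; rewrite -!mulnA leq_mul2l; apply/orP; right.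
have [_ _ _ _ dk] := goodJ kJ; rewrite -(ler_nat R) !natrM.
apply: le_trans (_ : m.+1%:R * (lam * (len k)%:R) <= _); first by rewrite ler_wpM2l ?ler0n.
rewrite mulrA ler_wpM2r ?ler0n //; move: kappa_ge0; rewrite /kappa subr_ge0; apply: le_trans.
by rewrite ler_wpM2r // ler_nat.
Qed.

Lemma admissible_greedy s : admissible m D J (greedy m D J s).
Proof.
rewrite /greedy; have := admissible_nil; elim: s [::] => //= j s IH A aA; apply: IH.
by case: ifP.
Qed.

Lemma inside_len i x : inside i x -> (len x <= len i)%N.
Proof. by rewrite /inside; lia. Qed.

(** Only the volumes of blocks containing [j] change, so the violated bound is at such a block;
    without [j], whose volume is at most lam times [D * len i], the volume misses the bound by at
    most this amount. [A'] stands for the final selection. *)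
Lemma reject_tight A A' j : admissible m D J A -> ~~ admissible m D J (j :: A) -> j \in J ->
  (forall i, (bvol A i <= bvol A' i)%N) -> exists2 i, tight A' i & inside i j.
Proof.
move=> aA /allPn[i iJ /allPn[k kJ]]; rewrite -ltnNge => viol jJ AA'.
have aik := allP (allP aA _ iJ) _ kJ.
have ij : inside i j.
  by apply: contraLR viol => /negbTE ij; rewrite -leqNgt bvol_cons ij add0n.
exists i => //; rewrite /tight iJ /=.
apply: le_trans (_ : (bvol A i)%:R <= _); last by rewrite ler_nat.
have [_ _ _ vj dj] := goodJ jJ; have [_ lk _ _ dk] := goodJ kJ.
have lji := inside_len ij.
have vj' : (vol j)%:R <= lam * (D * len i)%:R :> R.
  apply: le_trans (_ : (dur j * D)%:R <= _); first by rewrite ler_nat.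
  rewrite mulnC !natrM mulrCA ler_wpM2l ?ler0n //; apply: le_trans dj _.
  by rewrite ler_wpM2l // ler_nat.
move: viol; rewrite bvol_cons ij -(ltr_nat R) natrD !natrM natrD => viol.
have lk' : 0 < (len k)%:R :> R by rewrite ltr0n.
have Di : 0 <= D%:R * (len i)%:R :> R by rewrite mulr_ge0 ?ler0n.
rewrite natrM in vj' *; rewrite -(ler_pM2r lk') /kappa.
have h : D%:R * (len i)%:R * (m.+1%:R * (dur k)%:R) <=
    D%:R * (len i)%:R * (m.+1%:R * (lam * (len k)%:R)) :> R.
  by rewrite ler_wpM2l // ler_wpM2l ?ler0n.
have h2 := ler_wpM2r (ltW lk') vj'.
have -> : m.+2%:R = m.+1%:R + 1 :> R by rewrite natr1.
move: viol h h2; clear.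
move: (D%:R) (len i)%:R (len k)%:R (dur k)%:R (bvol A i)%:R (vol j)%:R (m%:R) (m.+1%:R) => *; lra.
Qed.

Lemma foldl_step_sub s A : {subset A <= foldl step A s}.
Proof.
elim: s A => [|j s IH] A x xA //=; apply: IH; rewrite /step; case: ifP => // _.
by rewrite inE xA orbT.
Qed.

Lemma foldl_step_subr s A : {subset foldl step A s <= A ++ s}.
Proof.
elim: s A => [|j s IH] A x /=; first by rewrite cats0.
move/IH; rewrite /step; case: ifP => _; rewrite !mem_cat !inE => /orP[];
  first [by move=> /orP[->|->]; rewrite ?orbT | by move=> ->; rewrite ?orbT].
Qed.

Lemma bvol_foldl_step s A i : (bvol A i <= bvol (foldl step A s) i)%N.
Proof.
elim: s A => [|j s IH] A //=; apply: leq_trans (IH _); rewrite /step.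
by case: ifP => // _; rewrite bvol_cons leq_addl.
Qed.

Lemma uniq_foldl_step (s A : seq item) : uniq (A ++ s) -> uniq (foldl step A s).
Proof.
elim: s A => [|j s IH] A /=; first by rewrite cats0.
move=> u; apply: IH; rewrite /step; case: ifP => _.
  by rewrite cat_cons -cat_rcons -cats1 -catA cat_uniq in u *; move: u; rewrite -cat_uniq uniq_catCA.
by move: u; rewrite !cat_uniq /= => /and3P[-> /norP[_ ->] /andP[_ ->]].
Qed.

Lemma greedy_cover (s A : seq item) : admissible m D J A -> {subset s <= J} ->
  forall x, x \in s -> (x \in foldl step A s) ||
    has (inside^~ x) [seq i <- J | tight (foldl step A s) i].
Proof.
elim: s A => [|j s IH] A aA sJ x //=; rewrite inE => /orP[/eqP ->|xs]; last first.
  apply: IH => //; first by rewrite /step; case: ifP.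
  by move=> y ys; apply: sJ; rewrite inE ys orbT.
have jJ : j \in J by apply: sJ; rewrite mem_head.
have [aj|nadm] := boolP (admissible m D J (j :: A)).
  by rewrite foldl_step_sub // /step aj mem_head.
rewrite [step A j]/step ifN //; have [i ti ij] := reject_tight aA nadm jJ (bvol_foldl_step s A).
by apply/orP; right; apply/hasP; exists i => //; rewrite mem_filter ti; case/andP: ti.
Qed.

(** Jobs of [O] in no tight block were all accepted and are compared with themselves, using
    [kappa <= 8 m]; the other ones are handled by [cover_bound]. *)
Lemma greedy_prefix (s : seq item) : uniq s -> {subset s <= J} ->
  kappa * (\sum_(x <- s | O x) vol x)%:R <= (8 * m)%:R * (\sum_(x <- greedy m D J s) vol x)%:R.
Proof.
move=> us sJ; set A := greedy m D J s.
have As : {subset A <= s} by move=> x /foldl_step_subr.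
set Ts := [seq i <- J | tight A i]; pose cov x := has (inside^~ x) Ts.
have sc x : x \in s -> (x \in A) || cov x := greedy_cover admissible_nil sJ (x := x).
have h1 : (\sum_(x <- s | O x && cov x) vol x <= \sum_(x <- J | O x && cov x) vol x)%N.
  by apply: leq_sum_sub => // x /sJ -> ->.
have h2 : (\sum_(x <- s | O x && ~~ cov x) vol x <= \sum_(x <- A | ~~ cov x) vol x)%N.
  by apply: leq_sum_sub => // x /sc + /andP[_ nc]; rewrite (negbTE nc) orbF => ->.
have h3 := @cover_bound A Ts (fun x xA => sJ _ (As x xA)) (filter_all _ _).
have k8 : kappa <= (8 * m)%:R.
  apply: le_trans (_ : m%:R <= _); last by rewrite ler_nat leq_pmull.
  by rewrite /kappa gerBl mulr_ge0 ?ler0n.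
rewrite (bigID cov) /= [in X in _ <= X](bigID cov) /= 2!natrD 2!mulrDr.
apply: lerD; first by apply: le_trans h3; rewrite ler_wpM2l // ler_nat.
by apply: ler_pM; rewrite ?ler0n // ler_nat.
Qed.

Variable w : item -> R.
Hypothesis w_ge0 : forall x, 0 <= w x.
Let density x := w x / (vol x)%:R.

(* Abel summation: the volume bounds on the prefixes are weighted by the
   successive decrements of the density. *)
Lemma abel (s A : seq item) (r c : R) : {subset s <= J} -> pairwise (fun x y => density y <= density x) s ->
  0 <= r -> (forall x, x \in s -> density x <= r) ->
  (forall k, 0 <= c + ((8 * m)%:R * ((\sum_(x <- foldl step A (take k s)) vol x)%:R
      - (\sum_(x <- A) vol x)%:R) - kappa * (\sum_(x <- take k s | O x) vol x)%:R)) ->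
  0 <= r * c + ((8 * m)%:R * (\sum_(x <- foldl step A s) w x - \sum_(x <- A) w x)
      - kappa * \sum_(x <- s | O x) w x).
Proof.
elim: s A r c => [|x s IH] A r c sJ /=.
  move=> _ r0 _ /(_ 0%N) /=; rewrite !big_nil !subrr !mulr0 subrr !addr0 => c0.
  by rewrite mulr_ge0.
move=> /andP[/allP dx pw] r0 dr Hk.
(* [c] is the volume surplus accumulated so far, nonnegative by the empty prefix; hence lowering its
   price from [r] to the density of [x] can only decrease its value. *)
have c0 : 0 <= c by have := Hk 0%N; rewrite /= big_nil subrr !mulr0 subrr addr0.
have xJ : x \in J by apply: sJ; rewrite mem_head.
have [_ _ vx _ _] := goodJ xJ.
have wx : w x = density x * (vol x)%:R.
  by rewrite /density divfK // pnatr_eq0 -lt0n.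
have xr : density x * c <= r * c by rewrite ler_wpM2r // dr ?mem_head.
pose b : R := (O x)%:R; pose a : R := (admissible m D J (x :: A))%:R.
have stepV : (\sum_(y <- step A x) vol y)%:R = (\sum_(y <- A) vol y)%:R + a * (vol x)%:R :> R.
  rewrite /step /a; case: ifP => _; rewrite ?mul0r ?addr0 // big_cons natrD mul1r addrC //.
have stepW : \sum_(y <- step A x) w y = \sum_(y <- A) w y + a * w x :> R.
  rewrite /step /a; case: ifP => _; rewrite ?mul0r ?addr0 // big_cons mul1r addrC //.
have OV u : (\sum_(y <- x :: u | O y) vol y)%:R = b * (vol x)%:R + (\sum_(y <- u | O y) vol y)%:R :> R.
  by rewrite big_cons /b; case: (O x); rewrite ?mul0r ?add0r // natrD mul1r.
have OW : \sum_(y <- x :: s | O y) w y = b * w x + \sum_(y <- s | O y) w y :> R.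
  by rewrite big_cons /b; case: (O x); rewrite ?mul0r ?add0r // mul1r.
have := IH (step A x) (density x) (c + ((8 * m)%:R * (a * (vol x)%:R) - kappa * (b * (vol x)%:R))).
rewrite {}stepV {}stepW => IH'.
have sJ' : {subset s <= J} by move=> y ys; apply: sJ; rewrite inE ys orbT.
have d0 : 0 <= density x by rewrite /density divr_ge0 ?ler0n.
have q k : 0 <= c + ((8 * m)%:R * (a * (vol x)%:R) - kappa * (b * (vol x)%:R)) +
   ((8 * m)%:R * ((\sum_(y <- foldl step (step A x) (take k s)) vol y)%:R -
     ((\sum_(y <- A) vol y)%:R + a * (vol x)%:R)) -
    kappa * (\sum_(y <- take k s | O y) vol y)%:R).
  have := Hk k.+1; rewrite [take _ _]/= OV /=.
  set V := (\sum_(_ <- foldl _ _ _) _)%:R; set V0 := (\sum_(_ <- A) _)%:R.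
  set V1 := (\sum_(_ <- take _ _ | _) _)%:R; clear.
  by move: V V0 V1 (8 * m)%:R kappa a b (vol x)%:R c => *; lra.
move: (IH' sJ' pw d0 dx q) xr; rewrite OW wx.
set V := \sum_(_ <- foldl _ _ _) _; set V0 := (\sum_(_ <- A) _).
set V1 := (\sum_(_ <- s | _) _).
move: (8 * m)%:R kappa (vol x)%:R (density x) => *; lra.
Qed.

Lemma greedy_profit (s : seq item) : perm_eq s J -> pairwise (fun x y => density y <= density x) s ->
  kappa * \sum_(x <- J | O x) w x <= (8 * m)%:R * \sum_(x <- greedy m D J s) w x.
Proof.
move=> sJ pw; have sub : {subset s <= J} by move=> x; rewrite (perm_mem sJ).
have us : uniq s by rewrite (perm_uniq sJ).
rewrite -(perm_big _ sJ) /= -subr_ge0.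
(* Any common upper bound of the densities serves, since the initial surplus is 0. *)
pose r := \sum_(x <- s) density x.
have d0 x : 0 <= density x by rewrite /density divr_ge0 ?ler0n.
have := @abel s [::] r 0 sub pw; rewrite mulr0 add0r !big_nil subr0; apply.
- by apply: sumr_ge0.
- move=> x xs; rewrite /r (big_rem x) //= lerDl; exact: sumr_ge0.
- move=> k; rewrite add0r subr0 subr_ge0.
  apply: greedy_prefix; first exact: take_uniq.
  by move=> x /mem_take /sub.
Qed.

End Greedy.

(** * Correctness and running time *)

Definition raw (x : job) : raw_job :=
  (release x, (deadline x, (proc x, ((`|numq (req x)|%N, `|denq (req x)|%N),
    (`|numq (profit x)|%N, `|denq (profit x)|%N))))).

Lemma enc_instanceE I : enc_instance I = enc (horizon I, (nhosts I, map raw (jobs I))).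
Proof.
rewrite /enc_instance; congr (Defs.Cons _ (Defs.Cons _ _)).
by elim: (jobs I) => //= x s ->.
Qed.

Lemma mapiE A B (f : nat -> A -> B) d s :
  mapi f s = rev [seq f k (nth d s k) | k <- iota 0 (size s)].
Proof.
have H u c t : (foldl (fun a e => (a.1.+1, f a.1 e :: a.2)) (c, u) t).2 =
    rev [seq f k (nth d t (k - c)) | k <- iota c (size t)] ++ u.
  elim: t c u => //= e t IH c u; rewrite IH rev_cons cat_rcons subnn; congr (rev _ ++ _).
  apply/eq_in_map => k; rewrite mem_iota => /andP[ck _]; congr f.
  by rewrite -(subnSK ck).
by rewrite /mapi H cats0; congr rev; apply: eq_map => k; rewrite subn0.
Qed.

(** * The items of an instance *)

Section Instance.
Variables (I : instance) (m : nat).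
Hypotheses (valI : valid I) (hostsI : nhosts I = m) (m_gt0 : 0 < m).

Implicit Type j : job_ix I.

Let js := map raw (jobs I).
Let D := scale js.
Let J := items js.
Definition item_of (j : job_ix I) : item := mk_item D j (raw (job_at j)).

Lemma perm_items : perm_eq J [seq item_of j | j <- enum 'I_(size (jobs I))].
Proof.
rewrite /J /items (mapiE _ (raw (Job 0 0 0 0%R 0%R))) perm_rev /js size_map -val_enum_ord -map_comp.
rewrite (_ : map _ _ = map item_of (enum 'I_(size (jobs I)))) //.
apply: eq_map => j /=; rewrite /item_of (nth_map (Job 0 0 0 0%R 0%R)) //.
by rewrite /job_at (tnth_nth (Job 0 0 0 0%R 0%R)).
Qed.

Lemma item_inj : injective item_of.
Proof. by move=> i j /(congr1 ident) /val_inj. Qed.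

Lemma itemP x : x \in J -> exists j, x = item_of j.
Proof. by rewrite (perm_mem perm_items) => /mapP[j _ ->]; exists j. Qed.

Lemma uniq_items : uniq J.
Proof. by rewrite (perm_uniq perm_items) map_inj_uniq ?enum_uniq //; exact: item_inj. Qed.

Lemma scaleE (s : seq raw_job) : scale s = \prod_(x <- s) x.2.2.2.1.2.
Proof.
rewrite /scale; suff H a : foldl (fun a (x : raw_job) => a * x.2.2.2.1.2) a s =
   a * \prod_(x <- s) x.2.2.2.1.2 by rewrite H mul1n.
by elim: s a => [|x s IH] a /=; rewrite ?big_nil ?muln1 // IH big_cons mulnA.
Qed.

Lemma D_gt0 : 0 < D.
Proof.
rewrite /D scaleE big_map; elim: (jobs I) => [|x s IH]; rewrite ?big_nil // big_cons muln_gt0 IH.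
by rewrite andbT /= absz_gt0 denq_eq0.
Qed.

Lemma den_dvd j : `|denq (req (job_at j))| %| D.
Proof. by rewrite /D scaleE big_map big_tnth (bigD1 j) //= dvdn_mulr. Qed.

Section Ratio.
Local Open Scope ring_scope.
Import Order.TTheory GRing.Theory Num.Theory.

Lemma natr_absz_ge0 (F : realDomainType) (z : int) : 0 <= z -> (`|z|%N)%:R = z%:~R :> F.
Proof. by move=> z0; rewrite natr_absz ger0_norm. Qed.

Lemma szE j : (sz (item_of j))%:R = req (job_at j) * D%:R :> rat.
Proof.
have [_ _ _ _ [r0 r1 _]] := valI j.
rewrite /sz /item_of /mk_item /= -/D natrM natr_absz_ge0 ?numq_ge0 ?ltW //.
have E := divnK (den_dvd j); rewrite -[in RHS]E natrM natr_absz_ge0 ?denq_ge0 //.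
rewrite -[X in _ = X * _]divq_num_den [_%:R * _]mulrC mulrA divfK ?intr_eq0 ?denq_eq0 //.
Qed.

Lemma halfw_bounds s : (0 < s <= D)%N -> [/\ (0 < halfw D s)%N, (halfw D s <= D)%N & (halfw D s <= 2 * s)%N].
Proof. by move=> /andP[s0 sD]; rewrite /halfw; case: ifP => h; split; lia. Qed.

Lemma sz_okE j : sz_ok D (item_of j).
Proof.
have [_ _ _ _ [r0 r1 _]] := valI j; rewrite /sz_ok -(ltr_nat rat) -(ler_nat rat) szE.
by rewrite mulr_gt0 ?ltr0n ?D_gt0 // ler_piMl // ler0n.
Qed.

Lemma volE j : vol (item_of j) = (proc (job_at j) * halfw D (sz (item_of j)))%N.
Proof. by []. Qed.

Lemma block_item j : [/\ dyadic (item_of j), (0 < len (item_of j))%N,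
  (release (job_at j) <= lo (item_of j))%N,
  (lo (item_of j) + len (item_of j) <= (deadline (job_at j)).+1)%N &
  (window_len (job_at j) <= 4 * len (item_of j))%N].
Proof.
have [_ rd _ _ _] := valI j; have [[k [b [E2 E1]]] h1 h2 h3 _] := block_spec rd.
split; rewrite /lo /len //=; first by exists k, b.
- by rewrite E2 expn_gt0.
- by rewrite /window_len -subSn.
Qed.

Variables (R : realType) (lambda : R).
Hypotheses (slackI : slack lambda I) (lambda_gt0 : 0 < lambda).
Let lam := 4 * lambda.
Hypothesis kappa_ge0 : 0 <= m%:R - m.+2%:R * lam.

Lemma item_good x : x \in J -> [/\ dyadic x, (0 < len x)%N, (0 < vol x)%N,
  (vol x <= dur x * D)%N & (dur x)%:R <= lam * (len x)%:R].
Proof.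
move=> /itemP[j ->]; have [h1 h2 _ _ h3] := block_item j.
have [_ _ _ p0 _] := valI j; have [u0 uD _] := halfw_bounds (sz_okE j); split=> //.
- by rewrite volE muln_gt0 p0.
- by rewrite volE leq_mul2l uD orbT.
(* The window is at most four times as long as the block, hence [lam] is [4 * lambda]. *)
- apply: le_trans (slackI j) _; rewrite /lam [4 * _]mulrC -mulrA ler_pM2l // -natrM.
  by rewrite ler_nat.
Qed.

Definition value (x : item) : R := (wnum x)%:R / (wden x)%:R.

Lemma valueE j : ratr (profit (job_at j)) = value (item_of j).
Proof.
have [_ _ _ _ [_ _ w0]] := valI j.
by rewrite /value /wnum /wden /= !natr_absz_ge0 ?numq_ge0 ?denq_ge0 // /ratr unlock.
Qed.

Lemma value_ge0 x : 0 <= value x.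
Proof. by rewrite divr_ge0 ?ler0n. Qed.

Lemma denserE x y : x \in J -> y \in J ->
  denser x y = (value y / (vol y)%:R <= value x / (vol x)%:R).
Proof.
have pos z : z \in J -> 0 < (wden z)%:R * (vol z)%:R :> R.
  move=> zJ; have [_ _ vz _ _] := item_good zJ; rewrite -natrM ltr0n muln_gt0 vz andbT.
  by have [j ->] := itemP zJ; rewrite /wden /= absz_gt0 denq_eq0.
move=> /pos px /pos py; rewrite /denser /value -!mulrA -!invfM ler_pdivrMr // mulrAC.
by rewrite ler_pdivlMr // -!natrM ler_nat !mulnA.
Qed.

Lemma leq_sum_range (F : nat -> nat) a b c d : (a <= c)%N -> (c <= d)%N -> (d <= b)%N ->
  (\sum_(c <= t < d) F t <= \sum_(a <= t < b) F t)%N.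
Proof.
move=> ac cd db; rewrite [leqRHS](big_cat_nat (n := c)) ?(leq_trans cd) //=.
by rewrite [X in (_ <= _ + X)%N](big_cat_nat (n := d)) //= addnCA leq_addr.
Qed.

(** * Comparison with an arbitrary feasible solution *)

Section Opt.
Variables (S : {set job_ix I}) (sigma : schedule I).
Hypothesis feasS : feasible S sigma.
Let O (x : item) : bool := [exists j, (j \in S) && (item_of j == x)].

Lemma item_O j : O (item_of j) = (j \in S).
Proof.
apply/existsP/idP => [[i /andP[iS /eqP/item_inj <-]] //|jS].
by exists j; rewrite jS eqxx.
Qed.

Lemma sum_items (V : nmodType) (F : item -> V) (p : pred item) :
  \sum_(x <- J | O x && p x) F x = \sum_(j in S | p (item_of j)) F (item_of j).
Proof.
rewrite (perm_big _ perm_items) /= big_map big_enum_cond /=.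
by apply: eq_bigl => j; rewrite item_O.
Qed.

Lemma slot_load i t : (\sum_(j in sigma i t) halfw D (sz (item_of j)) <= 2 * D)%N.
Proof.
have [_ _ cap _ _] := feasS.
apply: (@leq_trans (\sum_(j in sigma i t) 2 * sz (item_of j))).
  by apply: leq_sum => j _; have [] := halfw_bounds (sz_okE j).
rewrite -big_distrr leq_mul2l /= -(ler_nat rat) natr_sum.
rewrite (eq_bigr (fun j => req (job_at j) * D%:R)) => [|j _]; last exact: szE.
by rewrite -mulr_suml ler_piMl ?ler0n.
Qed.

Lemma opt_volume i : i \in J ->
  (\sum_(x <- J | O x && inside i x) vol x <= 8 * m * D * len i)%N.
Proof.
move=> iJ; have [di _ _ _ _] := item_good iJ.
have [_ win _ _ done] := feasS.
rewrite sum_items.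
pose a := region i; pose b := (region i + 4 * len i)%N.
apply: (@leq_trans (\sum_(j in S | inside i (item_of j))
    \sum_(a <= t < b) \sum_h (j \in sigma h t) * halfw D (sz (item_of j)))).
  apply: leq_sum => j /andP[jS ij]; have [_ rd _ _ _] := valI j.
  have /andP[i1 i2] := ij; have [ra db] := window_region di rd i1 i2.
  rewrite volE; under eq_bigr do rewrite -big_distrl; rewrite -big_distrl leq_mul2r /=.
  apply/orP; right; apply: leq_trans (done j jS) _; rewrite -sum1_count big_mkcond /=.
  apply: leq_trans (leq_sum_range _ ra (leqW rd) db); apply: leq_sum => t _.
  by case: existsP => // -[h jh]; rewrite (bigD1 h) //= jh.
rewrite exchange_big /=; apply: (@leq_trans (\sum_(a <= t < b) m * (2 * D))%N).
  apply: leq_sum => t _; rewrite exchange_big /= -[m in leqRHS]hostsI -[nhosts I in leqRHS]card_ord.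
  rewrite -sum_nat_const; apply: leq_sum => h _; apply: leq_trans (slot_load h t).
  rewrite big_mkcond [leqRHS]big_mkcond; apply: leq_sum => j _.
  by case: (j \in sigma h t); case: ifP => //; rewrite mul1n.
rewrite sum_nat_const_nat /a /b addKn; clear; lia.
Qed.

Lemma denser_sorted :
  pairwise (fun x y => value y / (vol y)%:R <= value x / (vol x)%:R) (isort denser J).
Proof.
have sJ : all (mem J) (isort denser J) by rewrite (perm_all _ (perm_isort _ _)); apply/allP.
have : pairwise denser (isort denser J).
  apply: (pairwise_isort (P := mem J)).
  - by move=> x y xJ yJ; rewrite !denserE // le_total.
  - by move=> x y z xJ yJ zJ; rewrite !denserE // => /[swap]; apply: le_trans.
  - exact/allP.
by apply: sub_in_pairwise sJ => x y xJ yJ; rewrite denserE.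
Qed.

Lemma opt_bound : (m%:R - m.+2%:R * lam) * ratr (total_profit S) <=
  (8 * m)%:R * \sum_(x <- accepted m js) value x.
Proof.
have lam_ge0 : 0 <= lam by rewrite mulr_ge0 // ltW.
have -> : ratr (total_profit S) = \sum_(x <- J | O x) value x.
  rewrite rmorph_sum /= (eq_bigl (fun x => O x && predT x)); last by move=> x; rewrite andbT.
  by rewrite sum_items; apply: eq_big => j; rewrite ?andbT // valueE.
rewrite /accepted -/D -/J.
apply: (greedy_profit m_gt0 D_gt0 uniq_items item_good kappa_ge0 lam_ge0 opt_volume
  value_ge0 _ denser_sorted).
exact: perm_isort.
Qed.

End Opt.

(** * Feasibility of the computed solution *)

Let A := accepted m js.

Lemma accepted_sub : {subset A <= J}.
Proof.
by move=> x /foldl_step_subr; rewrite cat0s (perm_mem (perm_isort _ _)).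
Qed.

Lemma uniq_accepted : uniq A.
Proof. by apply: uniq_foldl_step; rewrite /= (perm_uniq (perm_isort _ _)) uniq_items. Qed.

Lemma accepted_admissible i k : i \in J -> k \in J ->
  (bvol A i * len k + D * m.+1 * dur k * len i <= D * m * len k * len i)%N.
Proof.
move=> iJ kJ; have lam_ge0 : 0 <= lam by rewrite mulr_ge0 // ltW.
have := admissible_greedy item_good kappa_ge0 lam_ge0 (isort denser J).
by move=> /allP/(_ i iJ)/allP/(_ k kJ).
Qed.

Let T := horizon I.
Let segs := segments m T js.

Lemma segments_inv : exists P L done, perm_eq done A /\ sched_inv m D T.+1 P L done segs.
Proof.
have [P [L [L0 PL]]] : exists P L, (0 < L)%N /\ forall x, x \in A -> (dur x * L <= P * len x)%N /\
    (bvol A x * L + D * m.+1 * P * len x <= D * m * L * len x)%N.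
  have [J0|Jne] := eqVneq J [::].
    by exists 0%N, 1%N; split=> // x /accepted_sub; rewrite J0.
  (* A job attaining the largest ratio supplies [P / L]; [admissible] was tested against every job,
     hence against this one. *)
  have [k kJ Hk] := exists_max (fun x => (dur x)%:R / (len x)%:R : rat) Jne.
  have [_ lk _ _ _] := item_good kJ.
  exists (dur k), (len k); split=> // x /accepted_sub xJ; split; last exact: accepted_admissible.
  have [_ lx _ _ _] := item_good xJ; have := Hk x xJ.
  rewrite ler_pdivrMr ?ltr0n // mulrAC ler_pdivlMr ?ltr0n // -!natrM ler_nat //.
exists P, L.
set B := isort (fun x y => (len x <= len y)%N) A.
have BA : perm_eq B A := perm_isort _ _.
have [||||done [dB inv]] := @sched_ok m D T.+1 P L m_gt0 D_gt0 L0 B.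
- by [].
- by rewrite (perm_uniq BA) uniq_accepted.
- apply: pairwise_sorted; apply: (pairwise_isort (P := predT)).
  + by move=> x y _ _; apply: leq_total.
  + by move=> x y z _ _ _; apply: leq_trans.
  + by apply/allP.
- move=> x; rewrite (perm_mem BA) => xA; have [h1 h2] := PL x xA.
  have [j xj] := itemP (accepted_sub xA); have [b1 b2 b3 b4 b5] := block_item j.
  rewrite (bvol_perm _ BA); split=> //; rewrite xj.
  + by split; [apply: sz_okE | |].
  + by apply: leq_trans b4 _; have [_ _ dT _ _] := valI j.
by exists done; split=> //; apply: perm_trans dB BA.
Qed.

(** Turns the numbers output by the program into typed indices once they are known to be in
    range. *)
Lemma seq_lift (U V : Type) (f : U -> V) (s : seq V) (p : pred V) :
  (forall v, p v -> exists u, f u = v) -> all p s -> exists s', map f s' = s.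
Proof.
move=> H; elim: s => [|v s IH] /=; first by exists [::].
by move=> /andP[/H [u <-] /IH [s' <-]]; exists (u :: s').
Qed.

Let out := flatten [seq seg_runs m D g | g <- segs].

Definition run_code (r : run I) : nat * (nat * (nat * nat)) :=
  (val (run_job r), (val (run_host r), (run_first r, run_last r))).

Lemma uniq_map_inj (U V : eqType) (f : U -> V) (s : seq U) : uniq (map f s) ->
  {in s &, injective f}.
Proof.
elim: s => //= x s IH /andP[fx us] y z; rewrite !inE => /orP[/eqP ->|ys] /orP[/eqP ->|zs] // E.
- by case/negP: fx; rewrite E map_f.
- by case/negP: fx; rewrite -E map_f.
- exact: IH.
Qed.

(** The content is constant on a segment, so the packing computed once for the segment is that of
    each of its slots. *)
Lemma out_mem P L done j (i : nat) t : perm_eq done A -> sched_inv m D T.+1 P L done segs ->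
  has (fun q => [&& q.1 == val j, q.2.1 == i & (q.2.2.1 <= t <= q.2.2.2)%N]) out =
  ((i, item_of j) \in (pack m D (cont segs t)).2).
Proof.
move=> dA [ws mem_c uf _ _].
have ok_c u : all (sz_ok D) (cont segs u).
  apply/allP => x /mem_c [xd _]; rewrite (perm_mem dA) in xd.
  by have [j' ->] := itemP (accepted_sub xd); apply: sz_okE.
have pk u x : x \in (pack m D (cont segs u)).2 -> x.2 \in cont segs u.
  have [pq _ _] := pack_spec m_gt0 (ok_c u) (uf u).2.
  by move=> xp; rewrite -(perm_mem pq) map_f.
apply/hasP/idP => [[q /flattenP[r /mapP[g gs ->]] /mapP[x xg ->]] /= /and3P[/eqP xj /eqP xi]|H].
  move=> /andP[ft te].
  have ne := allP ws.1 _ gs.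
  have gt : cov t g by rewrite /cov ft /=; clear -ne te; lia.
  have E := cont_mem ws gs gt; rewrite -E in xg.
  have := pk _ _ xg => /mem_c [xd _]; rewrite (perm_mem dA) in xd.
  have [j' xj'] := itemP (accepted_sub xd).
  have jj : j' = j by apply: val_inj; move: xj; rewrite xj'.
  by rewrite -xi -jj -xj' -surjective_pairing.
have tT : (t < T.+1)%N.
  by rewrite ltnNge; apply/negP => Tt; move: H; rewrite (cont_out ws Tt).
have := ws.2 t; rewrite tT nseg_predT => ct; have /hasP[g gs gt] : has (cov t) segs.
  by rewrite has_count ct.
have E := cont_mem ws gs gt; rewrite E in H.
exists (ident (item_of j), (i, (g.1.1, (g.1.2 - 1)%N))).
  apply/flattenP; exists (seg_runs m D g); first exact: map_f.
  by apply/mapP; exists (i, item_of j).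
by move: gt; rewrite /cov /ident /= !eqxx /=; clear; case: g => [[f e] C] /=; lia.
Qed.

Lemma enc_seq_map (U V : Type) (eV : Enc V) (f : U -> V) (s : seq U) :
  enc_seq (fun u => enc (f u)) s = enc (map f s).
Proof. by rewrite /enc /enc_list /enc_seq foldr_map. Qed.

Lemma out_valid P L done : perm_eq done A -> sched_inv m D T.+1 P L done segs ->
  all (fun q => (q.1 < size (jobs I)) && (q.2.1 < nhosts I))%N out.
Proof.
move=> dA [ws mem_c uf _ _]; apply/allP => q /flattenP[r /mapP[g gs ->]] /mapP[hx hg ->] /=.
have gt : cov g.1.1 g by rewrite /cov leqnn; apply: (allP ws.1).
rewrite -(cont_mem ws gs gt) in hg.
have ok_c : all (sz_ok D) (cont segs g.1.1).
  apply/allP => x /mem_c [xd _]; rewrite (perm_mem dA) in xd.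
  by have [j' ->] := itemP (accepted_sub xd); apply: sz_okE.
have [pq hm _] := pack_spec m_gt0 ok_c (uf g.1.1).2.
rewrite hostsI (allP hm _ hg) andbT.
have : hx.2 \in cont segs g.1.1 by rewrite -(perm_mem pq) map_f.
move=> /mem_c [xd _]; rewrite (perm_mem dA) in xd.
by have [j ->] := itemP (accepted_sub xd); apply: ltn_ord.
Qed.

Lemma alg_solution : exists s : solution I,
  [/\ enc_solution s = enc (alg m (T, (nhosts I, js))),
      feasible (selected s) (sol_schedule s) &
      ratr (total_profit (selected s)) = \sum_(x <- A) value x].
Proof.
have [P [L [done [dA inv]]]] := segments_inv.
have [s1 Es1] : exists s1 : seq (job_ix I), map val s1 = map ident A.
  apply: (seq_lift (p := fun k => k < size (jobs I))%N) => [k kI|]; first by exists (Ordinal kI).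
  by apply/allP => _ /mapP[x /accepted_sub/itemP[j ->] ->]; apply: ltn_ord.
have [s2 Es2] : exists s2 : seq (run I), map run_code s2 = out.
  apply: seq_lift (out_valid dA inv) => -[k [h [f l]]] /= /andP[kI hI].
  by exists (Run (Ordinal kI) (Ordinal hI) f l).
pose s := Solution s1 s2; exists s.
have selE j : (j \in selected s) = (item_of j \in A).
  rewrite inE /= -(mem_map val_inj) Es1; apply/mapP/idP => [[x xA /= jx]|jA].
    have [i xi] := itemP (accepted_sub xA); rewrite xi in jx xA.
    by have -> : j = i by apply: val_inj.
  by exists (item_of j).
have schE i t j : (j \in sol_schedule s i t) = ((val i, item_of j) \in (pack m D (cont segs t)).2).
  by rewrite -(out_mem _ _ _ dA inv) -Es2 has_map inE; apply: eq_has.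
have [ws mem_c uf dur_c _] := inv.
have ok_c u : all (sz_ok D) (cont segs u).
  apply/allP => x /mem_c [xd _]; rewrite (perm_mem dA) in xd.
  by have [j' ->] := itemP (accepted_sub xd); apply: sz_okE.
have pk u := pack_spec m_gt0 (ok_c u) (uf u).2.
have in_c i t j : j \in sol_schedule s i t -> item_of j \in cont segs t.
  by rewrite schE => H; have [pq _ _] := pk t; rewrite -(perm_mem pq); apply: (map_f snd H).
split.
- rewrite /alg -/js -/D -/segs -/A -/out /enc_solution /= -Es1 -Es2.
  by congr (Defs.Cons _ _); rewrite -enc_seq_map.
- split.
  + move=> i t; apply/subsetP => j /in_c /mem_c [jd _].
    by rewrite selE -(perm_mem dA).
  + move=> i t j /in_c /mem_c [_ jt]; have [_ _ h1 h2 _] := block_item j.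
    by move: jt h1 h2; rewrite /in_window; clear; lia.
  + move=> i t; have [pq _ load] := pk t.
    have im : (val i < m)%N by rewrite -hostsI ltn_ord.
    have D0 : 0 < D%:R :> rat by rewrite ltr0n D_gt0.
    rewrite -(ler_pM2r D0) mul1r mulr_suml.
    rewrite (eq_bigr (fun j => (sz (item_of j))%:R)) => [|j _]; last by rewrite szE.
    rewrite -natr_sum ler_nat; apply: leq_trans (load _ im).
    rewrite (map_comp sz snd) sumnE big_map.
    rewrite -big_enum /= -(big_map (@item_of) predT sz).
    apply: leq_sum_sub => [|x /mapP[j]].
      by rewrite map_inj_uniq ?enum_uniq //; apply: item_inj.
    rewrite mem_enum schE andbT => H -> _.
    by apply/mapP; exists (val i, item_of j); rewrite // mem_filter /= eqxx.
  + move=> i i' t j; rewrite !schE => H H'; have [pq _ _] := pk t.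
    have up : uniq [seq hx.2 | hx <- (pack m D (cont segs t)).2].
      by rewrite (perm_uniq pq); have [] := uf t.
    by apply: val_inj; have [] := uniq_map_inj up H H' erefl.
  + move=> j; rewrite selE -(perm_mem dA) => jd.
    have h : (proc (job_at j) <= \sum_(lo (item_of j) <= t < lo (item_of j) + len (item_of j))
        (item_of j \in cont segs t))%N := dur_c _ jd.
    apply: leq_trans h _.
    have [_ _ h1 h2 _] := block_item j.
    rewrite -sum1_count [leqRHS]big_mkcond /=.
    apply: leq_trans _ (leq_sum_range _ h1 (leq_addr _ _) h2); apply: leq_sum => t _.
    case: (boolP (item_of j \in cont segs t)) => // jt; rewrite ifT //; apply/existsP.
    have [pq hm _] := pk t; move: jt; rewrite -(perm_mem pq) => /mapP[[h x] hx /= xE].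
    have hI : (h < nhosts I)%N by rewrite hostsI; apply: (allP hm _ hx).
    by exists (Ordinal hI); rewrite schE xE.
rewrite rmorph_sum /=.
have pA : perm_eq A [seq item_of j | j <- enum (selected s)].
  apply: uniq_perm => [||x]; first exact: uniq_accepted.
    by rewrite map_inj_uniq ?enum_uniq //; apply: item_inj.
  apply/idP/mapP => [xA|[j]]; last by rewrite mem_enum selE => jA ->.
  by have [j xj] := itemP (accepted_sub xA); exists j; rewrite // mem_enum selE -xj.
rewrite (perm_big _ pA) big_map big_enum /=.
by apply: eq_bigr => j _; rewrite valueE.
Qed.

End Ratio.

End Instance.

Local Open Scope ring_scope.
Import Order.TTheory GRing.Theory Num.Theory.

Theorem theorem3 (R : realType) (m : nat) (lambda : R) (hm : (1 <= m)%N)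
    (hlambda0 : 0 < lambda)
    (hlambda : lambda < 1 / 4 - 1 / (2 * (m%:R + 2))) :
  exists c : cmd,
    poly_time_solves c
      (fun I => [/\ valid I, nhosts I = m & slack lambda I])
      (fun I s => feasible (selected s) (sol_schedule s) /\
         (1 / 8 - lambda * (1 / 2 + 1 / m%:R)) * ratr (opt I)
           <= ratr (total_profit (selected s)) :> R).
Proof.
have m0 : 0 < m%:R :> R by rewrite ltr0n.
(* The bound assumed on [lambda] equals [m / (4 * (m + 2))]. *)
have kappa_ge0 : 0 <= m%:R - m.+2%:R * (4 * lambda).
  have m2 : 0 < m%:R + 2 :> R by rewrite addr_gt0.
  have -> : m.+2%:R = m%:R + 2 :> R by rewrite -addn2 natrD.
  rewrite subr_ge0 mulrCA mulrA -ler_pdivlMl ?mulr_gt0 //; apply: ltW.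
  apply: lt_le_trans hlambda _; rewrite le_eqVlt; apply/orP; left; apply/eqP.
  by field; move: m2; rewrite lt0r => /andP[].
have [c [N [k H]]] := PT_alg m; exists c.
exists (('X + 2%:P) ^+ k) => I [vI hI sI].
have [s [Es feas prof]] := alg_solution vI hI hm sI hlambda0 kappa_ge0.
have [st [q [Ex S0 _ B]]] := H _ (upd (fun=> Defs.Num 0) 0 (enc_instance I))
  (etrans (upd_same _ _ _) (enc_instanceE I)).
exists s, q; split=> //.
- by exists st; split=> //; rewrite S0 Es.
- apply: leq_trans (leq_trans (leq_addr _ _) B) _.
  by rewrite enc_instanceE horner_exp hornerD hornerX hornerC.
split=> //; rewrite prof.
have -> : 1 / 8 - lambda * (1 / 2 + 1 / m%:R) = (m%:R - m.+2%:R * (4 * lambda)) / (8 * m)%N%:R.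
  have -> : m.+2%:R = m%:R + 2 :> R by rewrite -addn2 natrD.
  by rewrite natrM; field; move: m0; rewrite lt0r => /andP[].
rewrite mulrAC ler_pdivrMr ?ltr0n ?muln_gt0 // [X in _ <= X]mulrC.
(* [opt] is an iterated maximum with default 0, so the bound is checked for 0, for a maximum of two
   values and for a single feasible set. *)
rewrite /opt; elim/big_ind: _ => [|x y hx hy|S0' /asboolP[sigma fS]].
- rewrite rmorph0 mulr0 mulr_ge0 ?ler0n // sumr_ge0 // => x _; exact: value_ge0.
- by rewrite maxEle; case: ifP.
exact: (opt_bound vI hI hm sI hlambda0 kappa_ge0 fS).
Qed.
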